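(* Let $G=\mathrm{SL}(3,\mathbb{C})$ act on $G\times G$ by simultaneous conjugation. The $\mathbb{C}$-algebra of invariants $\mathbb{C}[G\times G]^G$ is generated by $$\mathrm{tr}(\mathbf{x}_1),\ \mathrm{tr}(\mathbf{x}_2),\ \mathrm{tr}(\mathbf{x}_1\mathbf{x}_2),\ \mathrm{tr}(\mathbf{x}_1\mathbf{x}_2^{-1}),\ \mathrm{tr}(\mathbf{x}_1^{-1}),\ \mathrm{tr}(\mathbf{x}_2^{-1}),\ \mathrm{tr}(\mathbf{x}_1^{-1}\mathbf{x}_2^{-1}),\ \mathrm{tr}(\mathbf{x}_1^{-1}\mathbf{x}_2),\ \mathrm{tr}(\mathbf{x}_1\mathbf{x}_2\mathbf{x}_1^{-1}\mathbf{x}_2^{-1}).$$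
   Context: $\mathbb{C}[G\times G]$ is the coordinate ring of the affine variety $G\times G$, with $G$-action $(g\cdot f)(\mathbf{x}_1,\mathbf{x}_2)=f(g^{-1}\mathbf{x}_1g,g^{-1}\mathbf{x}_2g)$; $\mathbf{x}_1,\mathbf{x}_2$ are the generic $3\times3$ matrices of determinant $1$ whose entries are the coordinate functions on the first and second factor. *)

(* Defs.v *)
From HB Require Import structures.
From mathcomp Require Import all_boot all_order all_algebra.
From mathcomp Require Import boolp classical_sets functions reals complex.
From mathcomp Require Import mpoly.

Set Implicit Arguments.
Unset Strict Implicit.
Unset Printing Implicit Defensive.

Import GRing.Theory.
Local Open Scope classical_set_scope.
Local Open Scope ring_scope.

Record SL (K : comUnitRingType) (n : nat) := MkSL {
  SLmx :> 'M[K]_n;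
  _ : \det SLmx == 1
}.

Section SLGroup.
Variables (K : comUnitRingType) (n : nat).

HB.instance Definition _ := [isSub for @SLmx K n].
HB.instance Definition _ := [Choice of SL K n by <:].

Implicit Types A B : SL K n.

Lemma SL_det A : \det A = 1. Proof. exact/eqP/(valP A). Qed.

Lemma SL_unitmx A : (A : 'M_n) \in unitmx.
Proof. by rewrite unitmxE SL_det unitr1. Qed.

Fact SL_one_subproof : \det (1%:M : 'M[K]_n) == 1.
Proof. by rewrite det1. Qed.
Definition SL_one : SL K n := MkSL SL_one_subproof.

Fact SL_mul_subproof A B : \det (A *m B) == 1.
Proof. by rewrite det_mulmx !SL_det mulr1. Qed.
Definition SL_mul A B : SL K n := MkSL (SL_mul_subproof A B).

Fact SL_inv_subproof A : \det (invmx A) == 1.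
Proof. by rewrite det_inv SL_det invr1. Qed.
Definition SL_inv A : SL K n := MkSL (SL_inv_subproof A).

Fact SL_mulA : associative SL_mul.
Proof. by move=> A B D; apply/val_inj; rewrite /= mulmxA. Qed.
Fact SL_mul1 : left_id SL_one SL_mul.
Proof. by move=> A; apply/val_inj; rewrite /= mul1mx. Qed.
Fact SL_mulr1 : right_id SL_one SL_mul.
Proof. by move=> A; apply/val_inj; rewrite /= mulmx1. Qed.
Fact SL_mulV : left_inverse SL_one SL_inv SL_mul.
Proof. by move=> A; apply/val_inj; rewrite /= mulVmx ?SL_unitmx. Qed.
Fact SL_mulrV : right_inverse SL_one SL_inv SL_mul.
Proof. by move=> A; apply/val_inj; rewrite /= mulmxV ?SL_unitmx. Qed.

HB.instance Definition _ := isGroup.Build (SL K n)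
  SL_mulA SL_mul1 SL_mulr1 SL_mulV SL_mulrV.

End SLGroup.

Section Subalgebras.
Variables (K : comPzRingType) (X : Type).

(* Unital K-subalgebras of the algebra of all functions X -> K, with pointwise
   operations. *)
Definition subalgebra (S : set (X -> K)) : Prop :=
  [/\ S (cst 1),
      forall (a : K) f, S f -> S (a \*o f),
      forall f g, S f -> S g -> S (f \+ g) &
      forall f g, S f -> S g -> S (f \* g)].

Definition generated_subalgebra (S : set (X -> K)) : set (X -> K) :=
  smallest subalgebra S.

End Subalgebras.

(* For X embedded by iota as a Zariski-closed subset of K^m, with K an
   algebraically closed field, this is the coordinate ring K[X], seen inside
   the algebra of all functions X -> K. *)
Definition polynomial_functions (K : comNzRingType) (X : Type) (m : nat)
    (iota : X -> 'rV[K]_m) : set (X -> K) :=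
  [set f | exists p : {mpoly K[m]}, forall x, f x = p.@[iota x 0]].

Section SimultaneousConjugation.
Variables (K : comUnitRingType) (n : nat).
Local Notation G := (SL K n).

Definition SLpair_entries (x : G * G) : 'rV[K]_(n * n + n * n) :=
  row_mx (mxvec x.1) (mxvec x.2).

Definition SLpair_coordinate_ring : set (G * G -> K) :=
  polynomial_functions SLpair_entries.

Definition SLpair_act (g : G) (f : G * G -> K) : G * G -> K :=
  fun x => f (g^-1 * x.1 * g, g^-1 * x.2 * g)%g.

Definition SLpair_invariants : set (G * G -> K) :=
  [set f | SLpair_coordinate_ring f /\ forall g, SLpair_act g f = f].

End SimultaneousConjugation.

Arguments SLpair_coordinate_ring : clear implicits.
Arguments SLpair_invariants : clear implicits.

(* Main.v *)
Require Import Defs.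
From HB Require Import structures.
From mathcomp Require Import boolp classical_sets functions reals complex.
From mathcomp Require Import mpoly.
From mathcomp Require Import all_boot all_order all_fingroup all_algebra.
From mathcomp Require Import all_field ring zify.

(** Multiplying by powers of the determinants and separating the degrees modulo n
    with n-th roots of unity, an invariant function on SL x SL becomes a sum of
    bihomogeneous forms that are invariant on all pairs of matrices.  The
    polarization of such a form is tr (C (X_1 (x) ... (x) X_d)), where C commutes
    with all tensor powers of matrices; by the double centralizer theorem C is a
    combination of place permutations, so the form is a polynomial in traces of
    words.  For n = 3 the polarized Cayley-Hamilton identity rewrites x u x as
    - x x u - u x x modulo products of traces of shorter words.  It disposes of
    every word with at least four equal letters; among the finitely many cyclic
    words left, the only one of length greater than 4 that does not reduce is
    x x y y x y, which the commutator supplies. *)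

Set Implicit Arguments.
Unset Strict Implicit.
Unset Printing Implicit Defensive.

Import Order.TTheory GRing.Theory Num.Theory.
Local Open Scope ring_scope.

(** * Polarization *)

(** On SL a polynomial has no well-defined homogeneous components, because the determinant is 1;
    only degrees modulo n survive, and they are detected by scaling with n-th roots of unity, which
    preserves SL. Hence the n x n components, and hence the determinant factors that turn each of
    them into a form of a genuine bidegree. The matrix C of a form is far from unique. Symmetrizing
    it separately over the places of each of the two matrices makes its trace form the polarization,
    up to sign and scaling; this is a signed sum of values of the form, so it is invariant, and
    nondegeneracy of the trace passes the invariance on to C. For n = 3, determinant 1 makes each
    inverse a quadratic polynomial in the matrix with trace coefficients, so every generator
    containing inverses stands for one positive word. With at most three letters of each kind, words
    have length at most 6. There the cyclic words xxyyxy and xxyxyy have opposite traces modulo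
    polynomials in traces of shorter words, so a single commutator serves both. *)

Section Polarization.
Variables (K : numFieldType) (D : finType).

(** If some a lies outside A, toggling the membership of a pairs the supersets of A with opposite
    signs, so the sum is its own negative. *)
Lemma alternating_sum_supersets (A : {set D}) :
  \sum_(S : {set D} | A \subset S) (-1) ^+ #|S| =
  if A == [set: D] then (-1) ^+ #|D| else 0 :> K.
Proof.
case: eqP => [->|/eqP AT].
  rewrite (eq_bigl (pred1 [set: D])) ?big_pred1_eq ?cardsT // => S /=.
  by rewrite subTset.
have /subsetPn[a _ aA] : ~~ ([set: D] \subset A) by rewrite subTset.
pose tog (S : {set D}) := if a \in S then S :\ a else a |: S.
have togK : involutive tog.
  move=> S; rewrite /tog; case: (boolP (a \in S)) => aS.
    by rewrite setD11 setD1K.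
  by rewrite setU11 setU1K.
set s := LHS; suff : s = - s.
  by move/eqP; rewrite -addr_eq0 -mulr2n mulrn_eq0 /= => /eqP.
rewrite {1}/s (reindex_inj (inv_inj togK)) /= /s -sumrN.
apply: eq_big => S.
  rewrite /tog; case: ifP => aS.
    by rewrite subsetD1 aA andbT.
  apply/idP/idP => [/subsetP AS|AS]; last by rewrite (subset_trans AS) ?subsetUr.
  apply/subsetP => b bA; have := AS b bA; rewrite in_setU1 => /orP[/eqP ba|//].
  by rewrite -ba bA in aA.
move=> _; rewrite /tog; case: ifP => aS.
  by rewrite [in RHS](cardsD1 a) aS exprS mulN1r opprK.
by rewrite cardsU1 aS exprS mulN1r.
Qed.

(** Inclusion-exclusion: expanding the product gives a sum over colour-preserving maps f of [D] to
    itself, and the signed sum over the S containing the image of f leaves only the surjective ones,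
    which are permutations. Several colours polarize in several groups of variables at once. *)
Lemma polarization (C : eqType) (c : D -> C) (y : D -> D -> K) :
  \sum_(S : {set D})
     (-1) ^+ #|S| * \prod_k \sum_(i in S | c i == c k) y i k =
  (-1) ^+ #|D| *
  \sum_(s : {perm D} | [forall k, c (s k) == c k]) \prod_k y (s k) k.
Proof.
under eq_bigr => S _ do rewrite bigA_distr_big_dep /= mulr_sumr.
rewrite (exchange_big_dep xpredT) //=.
transitivity (\sum_(f : {ffun D -> D} | [forall k, c (f k) == c k])
   (if [set f k | k in D] == [set: D] then (-1) ^+ #|D| else 0)
     * \prod_k y (f k) k).
  rewrite [RHS]big_mkcond /=; apply: eq_bigr => f _.
  rewrite -mulr_suml; case: ifP => cf; last first.
    rewrite [X in X * _]big_pred0 ?mul0r // => S; apply/negbTE/negP => /familyP Sf.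
    by move/negP: cf; case; apply/forallP => k; have /andP[] := Sf k.
  congr (_ * _); rewrite -alternating_sum_supersets.
  apply: eq_bigl => S; apply/familyP/subsetP => [Sf _ /imsetP[k _ ->]|Sf k].
    by have /andP[] := Sf k.
  change (is_true ((f k \in S) && (c (f k) == c k))).
  by rewrite Sf ?imset_f //= (forallP cf).
rewrite mulr_sumr.
rewrite (eq_bigr (fun f : {ffun D -> D} => if injectiveb f then
  (-1) ^+ #|D| * \prod_k y (f k) k else 0)); last first.
  move=> f _.
  have -> : ([set f k | k in D] == [set: D]) = injectiveb f.
    rewrite eqEcard subsetT cardsT /=; apply/idP/injectiveP => [le|fi].
      have /imset_injP fi : #|[set f k | k in D]| == #|D|.
        by rewrite eqn_leq leq_imset_card.
      by move=> a b; apply: fi.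
    by rewrite card_imset.
  by case: ifP; rewrite ?mul0r.
rewrite -big_mkcondr /=.
rewrite (reindex (fun s : {perm D} => [ffun k => s k])) /=; last first.
  pose g (f : {ffun D -> D}) : {perm D} :=
    if injectiveP f is ReflectT fi then perm fi else 1%g.
  exists g => [s _|f /andP[_ fi]]; rewrite /g; case: injectiveP => // H.
  - by apply/permP => k; rewrite permE ffunE.
  - by case: H => a b; rewrite !ffunE => /perm_inj.
  - by apply/ffunP => k; rewrite ffunE permE.
  - by case: H; apply/injectiveP.
apply: eq_big => [s|s _].
  have -> : injectiveb [ffun k => s k].
    by apply/injectiveP => a b; rewrite !ffunE => /perm_inj.
  by rewrite andbT; apply: eq_forallb => k; rewrite ffunE.
by congr (_ * _); apply: eq_bigr => k _; rewrite ffunE.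
Qed.

End Polarization.

(** * The double centralizer of a finite group *)

(* As in Jacobson's density theorem, the averaged projection of the space of
   matrices onto the span of P acts on columns through the commutant of P, so
   it commutes with left multiplication by C; and it fixes the identity. *)
Lemma double_centralizer (K : numFieldType) (gT : finGroupType) (N : nat)
    (P : gT -> 'M[K]_N) (C : 'M[K]_N) :
  P 1%g = 1%:M -> (forall g h, P (g * h)%g = P g *m P h) ->
  (forall B, (forall g, P g *m B = B *m P g) -> C *m B = B *m C) ->
  exists a : gT -> K, C = \sum_g a g *: P g.
Proof.
move=> P1 PM CB.
pose S := \matrix_(i < #|gT|) mxvec (P (enum_val i)).
pose q (M : 'M_N) := vec_mx (mxvec M *m pinvmx S *m S).
have qlin : linear q.
  move=> a u v; rewrite /q linearP mulmxDl -scalemxAl mulmxDl -scalemxAl linearP. exact: erefl.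
pose qL : {linear 'M_N -> 'M_N} := HB.pack q
  (GRing.isLinear.Build _ _ _ _ q qlin).
have qS M : exists a : gT -> K, q M = \sum_g a g *: P g.
  exists (fun g => (mxvec M *m pinvmx S) 0 (enum_rank g)).
  rewrite /q mulmx_sum_row linear_sum /= (reindex enum_rank) /=; last first.
    exact/onW_bij/enum_rank_bij.
  by apply: eq_bigr => g _; rewrite linearZ /= rowK mxvecK enum_rankK.
have qP g : q (P g) = P g.
  rewrite /q mulmxKpV ?mxvecK //; apply/submxP.
  by exists (delta_mx 0 (enum_rank g)); rewrite -rowE rowK enum_rankK.
pose p (M : 'M_N) := #|gT|%:R^-1 *: \sum_g P g *m qL (P (g^-1)%g *m M).
have plin : linear p.
  move=> a u v; rewrite /p scalerA mulrC -scalerA -scalerDr; congr (_ *: _).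
  rewrite scaler_sumr -big_split; apply: eq_bigr => g _ /=.
  by rewrite mulmxDr -scalemxAr qlin mulmxDr -scalemxAr.
pose pL : {linear 'M_N -> 'M_N} := HB.pack p
  (GRing.isLinear.Build _ _ _ _ p plin).
have pP h M : p (P h *m M) = P h *m p M.
  rewrite /p -scalemxAr; congr (_ *: _); rewrite mulmx_sumr.
  rewrite (reindex_inj (mulgI h)); apply: eq_bigr => g _ /=.
  by rewrite mulmxA -PM invMg mulgKV PM mulmxA.
have card0 : #|gT|%:R != 0 :> K by rewrite pnatr_eq0 -lt0n; apply/card_gt0P; exists 1%g.
have p1 : p 1%:M = 1%:M.
  rewrite /p; under eq_bigr => g _ do rewrite mulmx1 /= qP -PM mulgV P1.
  by rewrite sumr_const -scaler_nat scalerA mulVf ?scale1r.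
have pS M : exists a : gT -> K, p M = \sum_g a g *: P g.
  rewrite /p.
  have /choice[f fP] : forall g, exists a : gT -> K,
      qL (P (g^-1)%g *m M) = \sum_h a h *: P h by move=> g; apply: qS.
  exists (fun h => #|gT|%:R^-1 * \sum_g f g (g^-1 * h)%g).
  under [RHS]eq_bigr => h _ do rewrite -scalerA scaler_suml.
  rewrite -scaler_sumr; congr (_ *: _); rewrite exchange_big.
  apply: eq_bigr => g _; rewrite fP mulmx_sumr (reindex_inj (mulgI g^-1%g)) /=.
  by apply: eq_bigr => h _; rewrite -scalemxAr -PM mulKVg.
(* [B i j] sends a column v to column j of [p] applied to the matrix whose column i is v and whose
   other columns vanish. Such an operator inherits from [pP] that it commutes with every [P g]. *)
pose B (i j : 'I_N) : 'M_N :=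
  \matrix_(a, b) (p (delta_mx b i)) a j.
have psum (J : finType) (F : J -> 'M_N) : p (\sum_i F i) = \sum_i p (F i).
  exact: (linear_sum pL).
have pZ (a : K) M : p (a *: M) = a *: p M by exact: (linearZ_LR pL).
have pB M : p M = \sum_i \sum_j B i j *m M *m delta_mx i j.
  apply/matrixP => a j; rewrite [M in LHS]matrix_sum_delta psum.
  under eq_bigr => b _ do rewrite psum.
  rewrite summxE; under eq_bigr => b _ do rewrite summxE.
  rewrite exchange_big summxE; apply: eq_bigr => i _.
  rewrite summxE [RHS](bigD1 j) //= [X in _ = _ + X]big1 ?addr0; last first.
    move=> k kj; rewrite mxE big1 // => b _.
    by rewrite !mxE [j == k]eq_sym (negbTE kj) andbF mulr0.
  rewrite [in RHS]mxE [RHS](bigD1 i) //= [X in _ = _ + X]big1 ?addr0; last first.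
    by move=> k ki; rewrite !mxE (negbTE ki) mulr0.
  rewrite !mxE !eqxx mulr1; apply: eq_bigr => b _.
  by rewrite pZ !mxE mulrC.
have BP i j g : P g *m B i j = B i j *m P g.
  apply/matrixP => a b.
  transitivity ((P g *m p (delta_mx b i)) a j).
    by rewrite !mxE; apply: eq_bigr => k _; rewrite !mxE.
  rewrite -pP.
  have -> : P g *m delta_mx b i = \sum_k P g k b *: delta_mx k i.
    apply/matrixP => x y; rewrite !mxE summxE.
    under [RHS]eq_bigr do rewrite !mxE.
    rewrite (bigD1 b) //= [X in _ + X]big1 => [|k kb]; last first.
      by rewrite !mxE (negbTE kb) mulr0.
    rewrite [RHS](bigD1 x) //= [X in _ = _ + X]big1 => [|k kx]; last first.
      by rewrite eq_sym (negbTE kx) mulr0.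
    by rewrite !mxE !eqxx.
  rewrite psum summxE mxE; apply: eq_bigr => k _.
  by rewrite pZ !mxE mulrC.
have pC M : p (C *m M) = C *m p M.
  rewrite !pB mulmx_sumr; apply: eq_bigr => i _; rewrite mulmx_sumr.
  by apply: eq_bigr => j _; rewrite !mulmxA CB // => g; apply: BP.
by rewrite -[C]mulmx1 -p1 -pC; apply: pS.
Qed.

(** * Tensor powers of matrices *)

Section Tensors.
Variables (K : numFieldType) (n : nat) (D : finType).
Local Notation I := {ffun D -> 'I_n}.
Local Notation N := #|{: I}|.
Local Notation ev := (@enum_val I predT).
Implicit Types (X Y : D -> 'M[K]_n) (a b : 'I_N) (s t : {perm D}).

(** The Kronecker product of the [X k]; multi-indices are numbered by [enum_val], so that it is an
    ordinary square matrix. *)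
Definition tens X : 'M[K]_N :=
  \matrix_(a, b) \prod_k X k (ev a k) (ev b k).

Lemma sum_enum_val (F : I -> K) : \sum_a F (ev a) = \sum_i F i.
Proof. by rewrite -(big_enum_val (A := predT)). Qed.

Lemma tensM X Y : tens X *m tens Y = tens (fun k => X k *m Y k).
Proof.
apply/matrixP => a b; rewrite !mxE.
under [RHS]eq_bigr do rewrite mxE.
rewrite bigA_distr_bigA /= -sum_enum_val; apply: eq_bigr => c _.
by rewrite !mxE -big_split.
Qed.

Lemma tens1 : tens (fun=> 1%:M) = 1%:M.
Proof.
apply/matrixP => a b; rewrite !mxE; case: (a =P b) => [->|ab].
  by rewrite big1 // => k _; rewrite mxE eqxx.
have [k kP] : exists k, ev a k != ev b k.
  apply/existsP; rewrite -negb_forall; apply/negP => /forallP H; apply: ab.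
  by apply: enum_val_inj; apply/ffunP => k; apply/eqP.
by rewrite (bigD1 k) //= mxE (negbTE kP) mul0r.
Qed.

Lemma tens_delta a b :
  tens (fun k => delta_mx (ev a k) (ev b k)) = delta_mx a b.
Proof.
apply/matrixP => c d; rewrite !mxE.
case: (c =P a) => [->|ca] /=.
  case: (d =P b) => [->|db] /=.
    by rewrite big1 // => k _; rewrite mxE !eqxx.
  have [k kP] : exists k, ev d k != ev b k.
    apply/existsP; rewrite -negb_forall; apply/negP => /forallP H; apply: db.
    by apply: enum_val_inj; apply/ffunP => k; apply/eqP.
  by rewrite (bigD1 k) //= mxE (negbTE kP) andbF mul0r.
have [k kP] : exists k, ev c k != ev a k.
  apply/existsP; rewrite -negb_forall; apply/negP => /forallP H; apply: ca.
  by apply: enum_val_inj; apply/ffunP => k; apply/eqP.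
by rewrite (bigD1 k) //= mxE (negbTE kP) mul0r.
Qed.

(** Precomposition gives a left action here because [(s * t) k] is [t (s k)]; this makes [tens_perm]
    multiplicative without inverses. *)
Definition place_perm s a : 'I_N := enum_rank [ffun k => ev a (s k)].

Lemma place_permM s t a : place_perm s (place_perm t a) = place_perm (s * t) a.
Proof.
rewrite /place_perm; congr enum_rank; apply/ffunP => k.
by rewrite !ffunE enum_rankK ffunE permM.
Qed.

Lemma place_perm1 a : place_perm 1 a = a.
Proof.
rewrite /place_perm -[RHS]enum_valK; congr enum_rank; apply/ffunP => k.
by rewrite ffunE perm1.
Qed.

Definition tens_perm s : 'M[K]_N := \matrix_(a, b) (a == place_perm s b)%:R.

Lemma tens_perm_mull s (M : 'M_N) a b :
  (tens_perm s *m M) a b = M (place_perm s^-1 a) b.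
Proof.
rewrite mxE (bigD1 (place_perm s^-1 a)) //= big1 => [|c ca].
  by rewrite mxE place_permM mulgV place_perm1 eqxx mul1r addr0.
rewrite mxE; case: (a =P place_perm s c) ca => [->|]; rewrite ?mul0r //.
by rewrite place_permM mulVg place_perm1 eqxx.
Qed.

Lemma tens_perm_mulr s (M : 'M_N) a b :
  (M *m tens_perm s) a b = M a (place_perm s b).
Proof.
rewrite mxE (bigD1 (place_perm s b)) //= big1 => [|c ca].
  by rewrite mxE eqxx mulr1 addr0.
by rewrite mxE (negbTE ca) mulr0.
Qed.

Lemma tens_permM s t : tens_perm (s * t) = tens_perm s *m tens_perm t.
Proof.
by apply/matrixP => a b; rewrite tens_perm_mulr !mxE place_permM.
Qed.

Lemma tens_perm1 : tens_perm 1 = 1%:M.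
Proof. by apply/matrixP => a b; rewrite !mxE place_perm1. Qed.

Lemma tens_permJ s X :
  tens_perm s *m tens X *m tens_perm s^-1 = tens (fun k => X (s k)).
Proof.
apply/matrixP => a b; rewrite tens_perm_mulr tens_perm_mull !mxE.
rewrite (reindex_inj (@perm_inj _ s)); apply: eq_bigr => k _.
by rewrite !enum_rankK !ffunE permK.
Qed.

(** With a constant [c] the left side contains only tensor powers of single matrices; with
    [left_slot] as [c] it contains only tensors built from two matrices. *)
Lemma tens_polarization (C : eqType) (c : D -> C) X :
  \sum_(S : {set D})
     (-1) ^+ #|S| *: tens (fun k => \sum_(i in S | c i == c k) X i) =
  (-1) ^+ #|D| *:
  \sum_(s : {perm D} | [forall k, c (s k) == c k])
     tens_perm s *m tens X *m tens_perm s^-1.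
Proof.
apply/matrixP => a b; rewrite summxE mxE summxE.
under eq_bigr do rewrite !mxE.
under [in RHS]eq_bigr do rewrite tens_permJ mxE.
rewrite -(polarization c (fun i k => X i (ev a k) (ev b k))).
by apply: eq_bigr => S _; congr (_ * _); apply: eq_bigr => k _; rewrite summxE.
Qed.

(** Elementary matrices are themselves pure tensors, so the trace pairing with pure tensors reads
    off every entry of [M]. *)
Lemma mxtrace_tens_inj (M : 'M[K]_N) :
  (forall X, \tr (M *m tens X) = 0) -> M = 0.
Proof.
move=> M0; apply/matrixP => a b; rewrite mxE.
rewrite -(M0 (fun k => delta_mx (ev b k) (ev a k))) tens_delta.
rewrite /mxtrace (bigD1 a) //= big1 => [|c ca].
  rewrite mxE (bigD1 b) //= big1 => [|c cb].
    by rewrite mxE !eqxx mulr1 !addr0.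
  by rewrite mxE (negbTE cb) mulr0.
rewrite mxE big1 // => d _.
by rewrite mxE (negbTE ca) andbF mulr0.
Qed.

(* By polarization the diagonal tensors span the commutant of the place
   permutations, so the double centralizer theorem applies. *)
Lemma tens_commutant (M : 'M[K]_N) :
  (forall g : 'M[K]_n, M *m tens (fun=> g) = tens (fun=> g) *m M) ->
  exists a : {perm D} -> K, M = \sum_s a s *: tens_perm s.
Proof.
move=> Mg; apply: double_centralizer tens_perm1 tens_permM _ => B BP.
pose E s (U : 'M_N) := tens_perm s *m U *m tens_perm s^-1.
have comE X : M *m (\sum_s E s (tens X)) = (\sum_s E s (tens X)) *m M.
  have -> : \sum_s E s (tens X) = (-1) ^+ #|D| *: \sum_(S : {set D})
     (-1) ^+ #|S| *: tens (fun k => \sum_(i in S | tt == tt) X i).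
    rewrite (tens_polarization (fun=> tt)) scalerA -exprMn mulrNN mulr1.
    rewrite expr1n scale1r; apply: eq_bigl => s.
    by apply/esym/forallP => k; rewrite eqxx.
  rewrite -scalemxAr -scalemxAl; congr (_ *: _).
  rewrite mulmx_sumr mulmx_suml; apply: eq_bigr => S _.
  rewrite -scalemxAr -scalemxAl; congr (_ *: _).
  exact: Mg.
(* Conjugation by place permutations fixes [B]. Averaging and then expanding in elementary tensors
   writes [B] through symmetrized pure tensors, with which [M] commutes by [comE]. *)
have BE : #|{perm D}|%:R *: B = \sum_s E s B.
  rewrite (eq_bigr (fun=> B)) => [|s _]; last first.
    by rewrite /E BP -mulmxA -tens_permM mulgV tens_perm1 mulmx1.
  by rewrite sumr_const -scaler_nat.
have {}BE : #|{perm D}|%:R *: B =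
    \sum_a \sum_b B a b *: \sum_s E s (delta_mx a b).
  rewrite BE [in LHS](matrix_sum_delta B).
  under eq_bigr => s _.
    rewrite /E mulmx_sumr mulmx_suml.
    under eq_bigr => a _.
      rewrite mulmx_sumr mulmx_suml.
      under eq_bigr => b _ do rewrite -scalemxAr -scalemxAl.
      over.
    over.
  rewrite exchange_big; apply: eq_bigr => a _.
  rewrite exchange_big; apply: eq_bigr => b _.
  by rewrite scaler_sumr.
have card0 : #|{perm D}|%:R != 0 :> K.
  by rewrite pnatr_eq0 -lt0n; apply/card_gt0P; exists 1%g.
apply: (scalerI card0); rewrite scalemxAr scalemxAl BE.
rewrite mulmx_sumr mulmx_suml; apply: eq_bigr => a _.
rewrite mulmx_sumr mulmx_suml; apply: eq_bigr => b _.
by rewrite -scalemxAr -scalemxAl -tens_delta comE.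
Qed.

End Tensors.

(** * Closure properties of subalgebras of functions *)

Section SubalgebraTheory.
Variables (K : comPzRingType) (X : Type) (S : set (X -> K)).
Hypothesis subS : subalgebra S.

Lemma subalgebra_const (a : K) : S (fun=> a).
Proof.
have [S1 SZ _ _] := subS.
by move: (SZ a _ S1); congr S; apply/funext => x; rewrite /= mulr1.
Qed.

Lemma subalgebraZ (a : K) f : S f -> S (fun x => a * f x).
Proof. by have [_ SZ _ _] := subS; apply: SZ. Qed.

Lemma subalgebraD f g : S f -> S g -> S (fun x => f x + g x).
Proof. by have [_ _ SD _] := subS; apply: SD. Qed.

Lemma subalgebraM f g : S f -> S g -> S (fun x => f x * g x).
Proof. by have [_ _ _ SM] := subS; apply: SM. Qed.

Lemma subalgebraN f : S f -> S (fun x => - f x).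
Proof.
by move/(subalgebraZ (-1)); congr S; apply/funext => x; rewrite mulN1r.
Qed.

Lemma subalgebraB f g : S f -> S g -> S (fun x => f x - g x).
Proof. by move=> Sf Sg; apply: subalgebraD (subalgebraN Sg). Qed.

Lemma subalgebra_sum (J : Type) (r : seq J) (P : pred J) (F : J -> X -> K) :
  (forall j, P j -> S (F j)) -> S (fun x => \sum_(j <- r | P j) F j x).
Proof.
move=> SF; elim: r => [|j r IH].
  by under eq_fun do rewrite big_nil; apply: subalgebra_const.
under eq_fun do rewrite big_cons; case Pj: (P j) => //.
exact: subalgebraD (SF _ Pj) IH.
Qed.

Lemma subalgebra_prod (J : Type) (r : seq J) (P : pred J) (F : J -> X -> K) :
  (forall j, P j -> S (F j)) -> S (fun x => \prod_(j <- r | P j) F j x).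
Proof.
move=> SF; elim: r => [|j r IH].
  by under eq_fun do rewrite big_nil; apply: subalgebra_const.
under eq_fun do rewrite big_cons; case Pj: (P j) => //.
exact: subalgebraM (SF _ Pj) IH.
Qed.

End SubalgebraTheory.

(** * Traces against place permutations as polynomials in traces of products *)

Section PermutationTraces.
Variables (K : numFieldType) (n : nat) (D : finType).
Local Notation I := {ffun D -> 'I_n}.

Lemma mxtrace_tens_perm (X : D -> 'M[K]_n) (s : {perm D}) :
  \tr (tens X *m tens_perm K n s) =
  \sum_(i : I) \prod_k X k (i k) (i (s k)).
Proof.
rewrite -sum_enum_val; apply: eq_bigr => a _.
rewrite tens_perm_mulr mxE; apply: eq_bigr => k _.
by rewrite /place_perm enum_rankK ffunE.
Qed.

(** Exchanging the extra index with the value of i at [k1] is an involution of the pairs summed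
    over; afterwards the extra index is free and contributes the factor n. *)
Lemma sum_ffun_update (H : I -> K) (k1 : D) :
  \sum_(i : I) \sum_(a < n) H [ffun k => if k == k1 then a else i k] =
  n%:R * \sum_i H i.
Proof.
rewrite pair_bigA /=.
pose psi (p : I * 'I_n) : I * 'I_n :=
  ([ffun k => if k == k1 then p.2 else p.1 k], p.1 k1).
have psiK : involutive psi.
  case=> i a; congr (_, _); rewrite /= ?ffunE ?eqxx //.
  by apply/ffunP => k; rewrite !ffunE; case: eqP => [->|].
rewrite (eq_bigr (fun p => H (psi p).1)) //.
rewrite -(reindex_inj (inv_inj psiK) (P := xpredT) (F := fun p => H p.1)) /=.
rewrite -(pair_bigA _ (fun i _ => H i)) /=.
under eq_bigr do rewrite sumr_const card_ord -mulr_natl.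
by rewrite mulr_sumr.
Qed.

(* Contracting the index at k1 = s k0 merges X k0 and X k1 into one factor and
   makes k1 a fixed point; the identity matrix left there contributes n. *)
Lemma permutation_trace_contract (X : D -> 'M[K]_n) (s : {perm D}) (k0 : D) :
  s k0 != k0 ->
  n%:R * \sum_(i : I) \prod_k X k (i k) (i (s k)) =
  \sum_(i : I) \prod_k
    (if k == k0 then X k0 *m X (s k0) else if k == s k0 then 1%:M else X k)
    (i k) (i ((tperm k0 (s k0) * s)%g k)).
Proof.
move=> sk0; rewrite -(sum_ffun_update _ (s k0)) /=; apply: eq_bigr => i _.
set k1 := s k0 in sk0 *.
under eq_bigr => a _.
  rewrite (bigD1 k0) //= (bigD1 k1) //= !ffunE eqxx.
  rewrite [k0 == k1]eq_sym (negbTE sk0).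
  rewrite (inj_eq (@perm_inj _ s) k1 k0) (negbTE sk0) mulrA.
  rewrite (eq_bigr (fun k => X k (i k) (i (s k)))); last first.
    move=> k /andP[kk0 kk1]; rewrite !ffunE (negbTE kk1).
    by rewrite (inj_eq (@perm_inj _ s) k k0) (negbTE kk0).
  over.
rewrite -mulr_suml [RHS](bigD1 k0) //= [in RHS](bigD1 k1) //=.
rewrite !permM tpermL tpermR eqxx (negbTE sk0) eqxx /= -/k1.
rewrite [1%:M _ _]mxE eqxx mul1r mxE; congr (_ * _).
apply: eq_bigr => k /andP[kk0 kk1].
rewrite (negbTE kk0) (negbTE kk1) permM tpermD //; first by rewrite eq_sym.
by rewrite eq_sym.
Qed.

(** Induction on the number of moved points replaces the cycle decomposition: each contraction fixes
    one more point and moves no new one, while the new factors stay in [W]. For the identity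
    permutation the sum factors into traces. *)
Lemma permutation_trace_in_subalgebra (T : Type) (A : set (T -> K))
    (W : (T -> 'M[K]_n) -> Prop) (X : D -> T -> 'M[K]_n) (s : {perm D}) :
  (0 < n)%N -> subalgebra A ->
  W (fun=> 1%:M) -> (forall U V, W U -> W V -> W (fun t => U t *m V t)) ->
  (forall U, W U -> A (fun t => \tr (U t))) -> (forall k, W (X k)) ->
  A (fun t => \tr (tens (X^~ t) *m tens_perm K n s)).
Proof.
move=> n0 subA W1 WM WA WX; under eq_fun do rewrite mxtrace_tens_perm.
have [m] := ubnP #|[set k | s k != k]|.
elim: m s X WX => // m IH s X WX; rewrite ltnS => sm.
have [/forallP s1|/forallPn[k0 sk0]] := boolP [forall k, s k == k].
  under eq_fun => t.
    under eq_bigr => i _ do under eq_bigr => k _ do rewrite (eqP (s1 k)).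
    rewrite -(bigA_distr_bigA (fun k i => X k t i i)); over.
  by apply: subalgebra_prod => // k _; apply: WA.
have nK : n%:R != 0 :> K by rewrite pnatr_eq0 -lt0n.
pose X' k t := if k == k0 then X k0 t *m X (s k0) t
               else if k == s k0 then 1%:M else X k t.
have /(subalgebraZ subA n%:R^-1) :
    A (fun t => \sum_(i : I) \prod_k X' k t (i k)
        (i ((tperm k0 (s k0) * s)%g k))).
  apply: IH => [k|].
    rewrite /X'; case: (k == k0); first exact: WM.
    by case: (k == s k0).
  apply: leq_trans sm; apply: proper_card; apply/properP; split.
    apply/subsetP => k; rewrite !inE; apply: contraNN => /eqP sk.
    rewrite permM tpermD ?sk //; apply/eqP => kE.
      by move: sk0; rewrite kE sk eqxx.
    have kk0 := perm_inj (etrans sk (esym kE)).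
    by move: sk0; rewrite kE kk0 eqxx.
  exists (s k0); rewrite !inE ?permM ?tpermR ?eqxx //.
  by rewrite (inj_eq (@perm_inj _ s)).
congr A; apply/funext => t.
by rewrite -permutation_trace_contract // mulKf.
Qed.

End PermutationTraces.

(** * Density of the special linear group *)

Section Density.
Variable K : numClosedFieldType.

Definition univariate_function : set (K -> K) :=
  fun phi => exists q : {poly K}, forall t, phi t = q.[t].

Lemma univariate_subalgebra : subalgebra univariate_function.
Proof.
split => [|a f [q fq]|f g [q fq] [r gr]|f g [q fq] [r gr]].
- by exists 1 => t; rewrite hornerE.
- by exists (a *: q) => t; rewrite /= fq !hornerE.
- by exists (q + r) => t; rewrite /= fq gr !hornerE.
- by exists (q * r) => t; rewrite /= fq gr !hornerE.
Qed.

Lemma univariate_shift_entry n (x : 'M[K]_n) i j :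
  univariate_function (fun t => (x + t%:M) i j).
Proof.
exists ((x i j)%:P + 'X *+ (i == j)) => t.
by rewrite !mxE hornerD hornerC hornerMn hornerX.
Qed.

Lemma poly_horner_eq0 (q : {poly K}) : (forall t, q.[t] = 0) -> q = 0.
Proof.
move=> q0; apply/eqP/negPn/negP => qN0.
have := max_poly_roots (rs := [seq k%:R | k <- iota 0 (size q)]) qN0.
rewrite size_map size_iota ltnn => H; apply: notF; apply: H.
  by apply/allP => x _; rewrite rootE q0.
rewrite map_inj_uniq ?iota_uniq // => a b /eqP.
by rewrite eqr_nat => /eqP.
Qed.

Lemma det_line_poly n (x : 'M[K]_n) :
  exists2 q : {poly K}, q != 0 & forall t, q.[t] = \det (x + t%:M).
Proof.
exists (char_poly (- x)); first exact/monic_neq0/char_poly_monic.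
move=> t; rewrite /char_poly -[LHS]/(horner_eval t _) -det_map_mx.
congr (\det _); apply/matrixP => i j.
rewrite !mxE /= /horner_eval hornerD hornerN hornerC hornerMn hornerX.
by rewrite opprK addrC.
Qed.

(** Homogeneity and an n-th root of the determinant carry the vanishing from SL to all invertible
    matrices. On the line x + t the product of [F] and the determinant is then the zero polynomial,
    and the determinant factor is nonzero, being a characteristic polynomial. *)
Lemma SL_density n d (F : 'M[K]_n -> K) :
  (0 < n)%N ->
  (forall s x, F (s *: x) = s ^+ d * F x) ->
  (forall x, univariate_function (fun t => F (x + t%:M))) ->
  (forall x, \det x = 1 -> F x = 0) -> forall x, F x = 0.
Proof.
move=> n0 Fh Fl F0.
have FGL x : \det x != 0 -> F x = 0.
  move=> dx; pose r := n.-root (\det x)^-1.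
  have rn : r ^+ n = (\det x)^-1 by apply: rootCK.
  have r0 : r != 0.
    by apply: contraNneq dx => r0; rewrite -invr_eq0 -rn r0 expr0n eqn0Ngt n0.
  have /eqP : F (r *: x) = 0 by apply: F0; rewrite detZ rn mulVf.
  by rewrite Fh mulf_eq0 expf_eq0 (negbTE r0) andbF => /eqP.
move=> x; have [q Fq] := Fl x; have [p p0 pE] := det_line_poly x.
have /eqP : q * p = 0.
  apply: poly_horner_eq0 => t; rewrite hornerM -Fq pE.
  by have [->|dN0] := eqVneq (\det (x + t%:M)) 0; rewrite ?mulr0 ?FGL ?mul0r.
rewrite mulf_eq0 (negbTE p0) orbF => /eqP q0.
have := Fq 0; rewrite q0 horner0 => <-; congr F.
by rewrite -[LHS]addr0; congr (_ + _); apply/matrixP => i j; rewrite !mxE mul0rn.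
Qed.

End Density.

(** * Bihomogeneous forms in the entries of two matrices *)

Section Forms.
Variables (K : numClosedFieldType) (n : nat).
Local Notation M := 'M[K]_n.

(** Bihomogeneous polynomial functions are generated inductively rather than cut out of [{mpoly}],
    so their properties follow by induction on the construction. The zero function has every
    bidegree, which allows empty sums. *)
Inductive biform : nat -> nat -> (M -> M -> K) -> Prop :=
| biform0 d e : biform d e (fun _ _ => 0)
| biform_const a : biform 0 0 (fun _ _ => a)
| biform_mulX1 d e F i j : biform d e F -> biform d.+1 e (fun x y => x i j * F x y)
| biform_mulX2 d e F i j : biform d e F -> biform d e.+1 (fun x y => y i j * F x y)
| biformD d e F G :
    biform d e F -> biform d e G -> biform d e (fun x y => F x y + G x y).

Lemma biform_ext d e F G : biform d e F -> (forall x y, F x y = G x y) -> biform d e G.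
Proof. by move=> fF FG; rewrite (_ : G = F) //; do 2!apply/funext => ?. Qed.

Lemma biformM d e F d' e' G : biform d e F -> biform d' e' G ->
  biform (d + d') (e + e') (fun x y => F x y * G x y).
Proof.
move=> fF fG; elim: fF => {d e F} [d e|a|d e F i j _ IH|d e F i j _ IH|d e F F' _ IH _ IH'].
- by apply: biform_ext (biform0 _ _) _ => x y; rewrite mul0r.
- elim: fG => {d' e' G} [d e|b|d e F i j _ IH|d e F i j _ IH|d e F F' _ IH _ IH'].
  + by apply: biform_ext (biform0 _ _) _ => x y; rewrite mulr0.
  + exact: biform_const.
  + by apply: biform_ext (biform_mulX1 i j IH) _ => x y; rewrite mulrCA.
  + by apply: biform_ext (biform_mulX2 i j IH) _ => x y; rewrite mulrCA.
  + by apply: biform_ext (biformD IH IH') _ => x y; rewrite mulrDr.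
- by apply: biform_ext (biform_mulX1 i j IH) _ => x y; rewrite mulrA.
- by apply: biform_ext (biform_mulX2 i j IH) _ => x y; rewrite mulrA.
- by apply: biform_ext (biformD IH IH') _ => x y; rewrite mulrDl.
Qed.

Lemma biformZ a d e F : biform d e F -> biform d e (fun x y => a * F x y).
Proof. exact: biformM (biform_const a). Qed.

Lemma biform_sum (J : Type) (r : seq J) (P : pred J) d e (F : J -> M -> M -> K) :
  (forall k, P k -> biform d e (F k)) ->
  biform d e (fun x y => \sum_(k <- r | P k) F k x y).
Proof.
move=> fF; elim: r => [|k r IH].
  by apply: biform_ext (biform0 _ _) _ => x y; rewrite big_nil.
case Pk: (P k); last by apply: biform_ext IH _ => x y; rewrite big_cons Pk.
by apply: biform_ext (biformD (fF _ Pk) IH) _ => x y; rewrite big_cons Pk.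
Qed.

Lemma biform_prod (J : Type) (r : seq J) (d e : J -> nat) (F : J -> M -> M -> K) :
  (forall k, biform (d k) (e k) (F k)) ->
  biform (\sum_(k <- r) d k) (\sum_(k <- r) e k)
    (fun x y => \prod_(k <- r) F k x y).
Proof.
move=> fF; elim: r => [|k r IH].
  by rewrite !big_nil; apply: biform_ext (biform_const 1) _ => x y; rewrite big_nil.
by rewrite !big_cons; apply: biform_ext (biformM (fF k) IH) _ => x y; rewrite big_cons.
Qed.

Lemma biformX d e F k :
  biform d e F -> biform (d * k) (e * k) (fun x y => F x y ^+ k).
Proof.
move=> fF; elim: k => [|k IH]; first by rewrite !muln0; apply: biform_const.
by rewrite !mulnS; apply: biform_ext (biformM fF IH) _ => x y; rewrite exprS.
Qed.

Lemma biform_entry1 i j : biform 1 0 (fun x y => x i j).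
Proof.
by apply: biform_ext (biform_mulX1 i j (biform_const 1)) _ => x y; rewrite mulr1.
Qed.

Lemma biform_entry2 i j : biform 0 1 (fun x y => y i j).
Proof.
by apply: biform_ext (biform_mulX2 i j (biform_const 1)) _ => x y; rewrite mulr1.
Qed.

Lemma biform_det1 : biform n 0 (fun x _ => \det x).
Proof.
apply: biform_sum => s _; apply: biformZ.
have := biform_prod (index_enum 'I_n) (fun i => biform_entry1 i (s i)).
by rewrite !sum_nat_const /= card_ord muln0 muln1.
Qed.

Lemma biform_det2 : biform 0 n (fun _ y => \det y).
Proof.
apply: biform_sum => s _; apply: biformZ.
have := biform_prod (index_enum 'I_n) (fun i => biform_entry2 i (s i)).
by rewrite !sum_nat_const /= card_ord muln0 muln1.
Qed.

Lemma biform_scale d e F s t x y :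
  biform d e F -> F (s *: x) (t *: y) = s ^+ d * t ^+ e * F x y.
Proof.
elim=> {d e F} [d e|a|d e F i j _ IH|d e F i j _ IH|d e F F' _ IH _ IH'].
- by rewrite mulr0.
- by rewrite !expr0 !mul1r.
- by rewrite IH mxE exprS; ring.
- by rewrite IH mxE exprS; ring.
- by rewrite IH IH' mulrDr.
Qed.

Lemma biform_univariate1 d e F x y :
  biform d e F -> univariate_function (fun t => F (x + t%:M) y).
Proof.
have subU := univariate_subalgebra K.
elim=> {d e F} [d e|a|d e F i j _ IH|d e F i j _ IH|d e F F' _ IH _ IH'].
- exact: subalgebra_const.
- exact: subalgebra_const.
- exact: subalgebraM (univariate_shift_entry _ _ _) IH.
- exact: subalgebraM (subalgebra_const _ _) IH.
- exact: subalgebraD.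
Qed.

Lemma biform_univariate2 d e F x y :
  biform d e F -> univariate_function (fun t => F x (y + t%:M)).
Proof.
have subU := univariate_subalgebra K.
elim=> {d e F} [d e|a|d e F i j _ IH|d e F i j _ IH|d e F F' _ IH _ IH'].
- exact: subalgebra_const.
- exact: subalgebra_const.
- exact: subalgebraM (subalgebra_const _ _) IH.
- exact: subalgebraM (univariate_shift_entry _ _ _) IH.
- exact: subalgebraD.
Qed.

End Forms.

(** * Invariant forms *)

Section InvariantForms.
Variables (K : numClosedFieldType) (n d e : nat).
Hypothesis n_gt0 : (0 < n)%N.
Local Notation M := 'M[K]_n.
Local Notation D := ('I_d + 'I_e)%type.

Definition left_slot (k : D) : bool := if k is inl _ then true else false.

Definition slots (x y : M) (k : D) : M := if left_slot k then x else y.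

(** A monomial is a single entry of the tensor, in the row of its first indices and the column of
    its second ones; the trace against an elementary matrix extracts it. *)
Lemma monomial_tens (s s' : seq ('I_n * 'I_n)) : size s = d -> size s' = e ->
  exists C : 'M[K]_#|{: {ffun D -> 'I_n}}|, forall x y : M,
    (\prod_(p <- s) x p.1 p.2) * (\prod_(p <- s') y p.1 p.2) =
    \tr (C *m tens (slots x y)).
Proof.
move=> sd se; pose p0 := (Ordinal n_gt0, Ordinal n_gt0).
pose w (k : D) := match k with inl k => nth p0 s k | inr k => nth p0 s' k end.
pose u : {ffun D -> 'I_n} := [ffun k => (w k).1].
pose v : {ffun D -> 'I_n} := [ffun k => (w k).2].
exists (delta_mx (enum_rank v) (enum_rank u)) => x y.
rewrite /mxtrace [RHS](bigD1 (enum_rank v)) //= [X in _ = _ + X]big1 => [|a av]; last first.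
  by rewrite mxE big1 // => b _; rewrite mxE (negbTE av) mul0r.
rewrite addr0 mxE [RHS](bigD1 (enum_rank u)) //= [X in _ = _ + X]big1 => [|a au]; last first.
  by rewrite mxE (negbTE au) andbF mul0r.
rewrite addr0 [delta_mx _ _ _ _]mxE !eqxx mul1r mxE !enum_rankK.
rewrite big_sumType /=; congr (_ * _).
  rewrite (big_nth p0) big_mkord sd; apply: eq_bigr => k _.
  by rewrite !ffunE.
rewrite (big_nth p0) big_mkord se; apply: eq_bigr => k _.
by rewrite !ffunE.
Qed.

Lemma biform_monomials d' e' (F : M -> M -> K) : biform d' e' F ->
  exists2 L : seq (K * (seq ('I_n * 'I_n) * seq ('I_n * 'I_n))),
    forall l, l \in L -> size l.2.1 = d' /\ size l.2.2 = e' &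
    forall x y, F x y = \sum_(l <- L) l.1 *
      ((\prod_(p <- l.2.1) x p.1 p.2) * (\prod_(p <- l.2.2) y p.1 p.2)).
Proof.
elim=> {d' e' F} [d' e'|a|d' e' F i j _ [L sL FL]|d' e' F i j _ [L sL FL]
  |d' e' F G _ [L sL FL] _ [L' sL' FL']].
- by exists [::] => // x y; rewrite big_nil.
- exists [:: (a, ([::], [::]))] => [l|x y]; first by rewrite inE => /eqP ->.
  by rewrite big_seq1 !big_nil !mulr1.
- exists [seq (l.1, ((i, j) :: l.2.1, l.2.2)) | l <- L] => [l|x y].
    by case/mapP => m /sL[s1 s2] -> /=; rewrite s1.
  rewrite FL big_map mulr_sumr; apply: eq_bigr => l _.
  by rewrite /= big_cons /=; ring.
- exists [seq (l.1, (l.2.1, (i, j) :: l.2.2)) | l <- L] => [l|x y].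
    by case/mapP => m /sL[s1 s2] -> /=; rewrite s2.
  rewrite FL big_map mulr_sumr; apply: eq_bigr => l _.
  by rewrite /= big_cons /=; ring.
- exists (L ++ L') => [l|x y]; first by rewrite mem_cat => /orP[/sL|/sL'].
  by rewrite big_cat FL FL'.
Qed.

Lemma biform_tens (F : M -> M -> K) : biform d e F ->
  exists C : 'M[K]_#|{: {ffun D -> 'I_n}}|,
    forall x y, F x y = \tr (C *m tens (slots x y)).
Proof.
case/biform_monomials => L sL FL.
suff [C CL] : exists C : 'M[K]_#|{: {ffun D -> 'I_n}}|, forall x y : M,
    \sum_(l <- L) l.1 * ((\prod_(p <- l.2.1) x p.1 p.2) *
      (\prod_(p <- l.2.2) y p.1 p.2)) = \tr (C *m tens (slots x y)).
  by exists C => x y; rewrite FL.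
elim: L sL {FL} => [|l L IH] sL.
  by exists 0 => x y; rewrite big_nil mul0mx mxtrace0.
have [|C CL] := IH; first by move=> m mL; apply: sL; rewrite inE mL orbT.
have [s1 s2] := sL l (mem_head _ _); have [C' CE] := monomial_tens s1 s2.
exists (l.1 *: C' + C) => x y.
by rewrite big_cons CE CL mulmxDl -scalemxAl mxtraceD mxtraceZ.
Qed.

Variable F : M -> M -> K.
Hypothesis biformF : biform d e F.
Hypothesis invF : forall g x y : M, \det g = 1 ->
  F (invmx g *m x *m g) (invmx g *m y *m g) = F x y.

(** Up to sign, the multilinear form of [F] symmetrized within each group of places; since it is
    written through values of [F] alone, it inherits the invariance. *)
Let polar (X : D -> M) := \sum_(S : {set D}) (-1) ^+ #|S| *
  F (\sum_(i in S | left_slot i == true) X i)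
    (\sum_(i in S | left_slot i == false) X i).

Let polar_inv g X : \det g = 1 ->
  polar (fun k => invmx g *m X k *m g) = polar X.
Proof.
move=> dg; apply: eq_bigr => S _; congr (_ * _).
by rewrite -!mulmx_suml -!mulmx_sumr invF.
Qed.

(** The Young subgroup preserving the two groups of places. *)
Let G := [pred s : {perm D} | [forall k, left_slot (s k) == left_slot k]].

(** A matrix representing [F] need not commute with anything. Its symmetrization over [G] has a
    trace form equal to [polar] up to sign, hence conjugation invariant, and [mxtrace_tens_inj]
    turns this into commutation. *)
Lemma invariant_form_tens :
  exists C : 'M[K]_#|{: {ffun D -> 'I_n}}|,
    (forall g : M, \det g = 1 -> tens (fun=> g) *m C = C *m tens (fun=> g)) /\
    forall x y, F x y = \tr (C *m tens (slots x y)).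
Proof.
have [C0 FC] := biform_tens biformF.
pose C := \sum_(s in G) tens_perm K n s^-1 *m C0 *m tens_perm K n s.
have polarE X : polar X = (-1) ^+ #|{: D}| * \tr (C *m tens X).
  transitivity (\tr (C0 *m \sum_(S : {set D}) (-1) ^+ #|S| *:
      tens (fun k => \sum_(i in S | left_slot i == left_slot k) X i))).
    rewrite mulmx_sumr raddf_sum; apply: eq_bigr => S _ /=.
    rewrite -scalemxAr mxtraceZ FC; congr (_ * \tr (_ *m _)).
    by apply/matrixP => a b; rewrite !mxE; apply: eq_bigr => k _; rewrite /slots; case: (left_slot k).
  rewrite tens_polarization -scalemxAr mxtraceZ mulmx_sumr; congr (_ * _).
  rewrite mulmx_suml !raddf_sum; apply: eq_bigr => s _ /=.
  by rewrite !mulmxA mxtrace_mulC !mulmxA.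
have G0 : #|G|%:R != 0 :> K.
  rewrite pnatr_eq0 -lt0n; apply/card_gt0P; exists 1%g.
  by rewrite inE; apply/forallP => k; rewrite perm1.
(* Permutations in [G] leave [slots x y] unchanged, so each summand of [C] contributes [F x y]. *)
have FE x y : #|G|%:R * F x y = \tr (C *m tens (slots x y)).
  rewrite mulmx_suml raddf_sum /= mulr_natl -sumr_const.
  apply: eq_bigr => s; rewrite inE => /forallP sG.
  rewrite FC -!mulmxA [RHS]mxtrace_mulC -!mulmxA [X in _ = \tr (_ *m X)]mulmxA tens_permJ.
  congr (\tr (_ *m _)); apply/matrixP => a b; rewrite !mxE.
  by apply: eq_bigr => k _; rewrite /slots (eqP (sG k)).
have comC g : \det g = 1 -> tens (fun=> g) *m C = C *m tens (fun=> g).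
  move=> dg; have gU : g \in unitmx by rewrite unitmxE dg unitr1.
  pose V := tens (fun _ : D => invmx g).
  have VK : V *m tens (fun=> g) = 1%:M.
    by rewrite tensM -tens1; congr tens; apply/funext => k; rewrite mulVmx.
  suff E : tens (fun=> g) *m C *m V - C = 0.
    move/eqP: E; rewrite subr_eq0 => /eqP {2}<-.
    by rewrite -[RHS]mulmxA VK mulmx1.
  apply: mxtrace_tens_inj => X.
  rewrite mulmxBl raddfB /= -!mulmxA mxtrace_mulC -!mulmxA !tensM.
  apply/eqP; rewrite subr_eq0; apply/eqP.
  apply: (mulfI (x := (-1) ^+ #|{: D}|)); first by rewrite signr_eq0.
  rewrite -!polarE -[RHS](polar_inv _ dg); congr polar; apply/funext => k.
  by rewrite mulmxA.
exists (#|G|%:R^-1 *: C); split=> [g dg|x y].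
  by rewrite -scalemxAr -scalemxAl comC.
by rewrite -scalemxAl mxtraceZ -FE mulKf.
Qed.

(** Each entry of the commutator of [C] with the tensor power of g is homogeneous in g, of degree
    the number of places. By density commutation extends from SL to all matrices, as
    [tens_commutant] requires. *)
Lemma invariant_biform_perm : exists a : {perm D} -> K, forall x y,
  F x y = \sum_s a s * \tr (tens (slots x y) *m tens_perm K n s).
Proof.
have [C [comC FC]] := invariant_form_tens.
have subU := univariate_subalgebra K.
have [|a CE] := @tens_commutant K n _ C.
  move=> g; apply/matrixP => a b; apply/eqP; rewrite -subr_eq0; apply/eqP.
  move: g; apply: (SL_density (d := #|{: D}|)) => // [s x|x|x dx].
  - rewrite mulrBr !mxE !mulr_sumr; congr (_ - _); apply: eq_bigr => c _.
      rewrite !mxE mulrCA; congr (_ * _); rewrite -prodr_const -big_split.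
      by apply: eq_bigr => k _; rewrite mxE.
    rewrite !mxE mulrA; congr (_ * _); rewrite -prodr_const -big_split.
    by apply: eq_bigr => k _; rewrite mxE.
  - have ut c c' : univariate_function (fun t =>
        (tens (fun _ : D => x + t%:M)) c c').
      under eq_fun do rewrite mxE.
      by apply: subalgebra_prod => // k _; apply: univariate_shift_entry.
    by apply: subalgebraB => //; under eq_fun do rewrite mxE;
      apply: subalgebra_sum => // c _; apply: subalgebraM => //;
      apply: subalgebra_const.
  - by rewrite comC ?subrr.
exists a => x y; rewrite FC CE mulmx_suml raddf_sum; apply: eq_bigr => s _ /=.
by rewrite -scalemxAl mxtraceZ mxtrace_mulC.
Qed.

End InvariantForms.

(** * Invariants of pairs of matrices of determinant one *)

Lemma roots_of_unity_seq (K : numClosedFieldType) n : (0 < n)%N ->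
  exists rs : seq K, [/\ uniq rs, size rs = n & {in rs, forall z, z ^+ n = 1}].
Proof.
move=> n0; have [rs rsE] := closed_field_poly_normal ('X^n - 1 : {poly K}).
move: rsE; rewrite (monicP (monicXnsubC 1 n0)) scale1r => rsE.
exists rs; split.
- rewrite -separable_prod_XsubC -rsE separable_Xn_sub_1 //.
  by rewrite pnatr_eq0 -lt0n.
- by apply: succn_inj; rewrite -(size_prod_XsubC rs id) -rsE size_XnsubC.
- move=> z zrs; apply/eqP; rewrite -subr_eq0.
  have : root ('X^n - 1) z by rewrite rsE root_prod_XsubC.
  by rewrite /root !hornerE.
Qed.

(** The Vandermonde argument: the [r a] are the coefficients of a polynomial of degree less than n
    with n distinct roots. *)
Lemma power_sums_eq0 (K : fieldType) n (rs : seq K) (r : 'I_n -> K) :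
  uniq rs -> size rs = n -> {in rs, forall z, \sum_(a < n) z ^+ a * r a = 0} ->
  forall a, r a = 0.
Proof.
move=> urs srs H a; pose p := rVpoly (\row_a r a).
suff p0 : p = 0 by have := coef_rVpoly_ord (\row_a r a) a; rewrite -/p p0 coef0 mxE.
apply/eqP/negPn/negP => pN0; have := max_poly_roots pN0 _ urs.
rewrite srs ltnNge size_poly => F; apply: notF; apply: F.
apply/allP => z /H zH; apply/eqP.
rewrite (horner_coef_wide _ (size_poly _ _)) -[RHS]zH.
by apply: eq_bigr => b _; rewrite coef_rVpoly_ord mxE mulrC.
Qed.

Section Decomposition.
Variables (K : numClosedFieldType) (n : nat) (p : {mpoly K[n * n + n * n]}).
Hypothesis n_gt0 : (0 < n)%N.
Local Notation M := 'M[K]_n.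

Let phi (x y : M) := p.@[row_mx (mxvec x) (mxvec y) 0].

Lemma biform_entry (v : 'I_(n * n + n * n)) :
  exists de, biform de.1 de.2 (fun x y : M => row_mx (mxvec x) (mxvec y) 0 v).
Proof.
case: (split_ordP v) => w ->; case/mxvec_indexP: w => i j.
  exists (1%N, 0%N); apply: biform_ext (biform_entry1 K i j) _ => x y.
  by rewrite row_mxEl mxvecE.
exists (0%N, 1%N); apply: biform_ext (biform_entry2 K i j) _ => x y.
by rewrite row_mxEr mxvecE.
Qed.

Lemma biform_mnm (m : 'X_{1.. n * n + n * n}) :
  exists de, biform de.1 de.2
    (fun x y : M => \prod_v row_mx (mxvec x) (mxvec y) 0 v ^+ m v).
Proof.
have /choice[de deE] := biform_entry.
exists (\sum_v (de v).1 * m v, \sum_v (de v).2 * m v)%N.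
exact: biform_prod (fun v => biformX (m v) (deE v)).
Qed.

(* Multiplying by determinants, which does not change the values on SL, brings
   all degrees in a given residue class modulo n to a common value. *)
Lemma biform_decomposition :
  exists (D : nat) (P : 'I_n -> 'I_n -> M -> M -> K),
    (forall a b : 'I_n, biform (a + n * D) (b + n * D) (P a b)) /\
    forall x y, \det x = 1 -> \det y = 1 -> phi x y = \sum_a \sum_b P a b x y.
Proof.
have /choice[de deE] := biform_mnm.
(* A crude bound for all the quotients by n: a degree q n + r is raised to r + n D by the
   determinant to the power D - q, and D must be at least q. *)
pose D := (\sum_(m <- msupp p) ((de m).1 + (de m).2))%N.
pose md k : 'I_n := Ordinal (ltn_pmod k n_gt0).
pose Q (m : 'X_{1.. n * n + n * n}) (x y : M) := p@_m *
  ((\prod_v row_mx (mxvec x) (mxvec y) 0 v ^+ m v) *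
  (\det x ^+ (D - (de m).1 %/ n) * \det y ^+ (D - (de m).2 %/ n))).
pose P (a b : 'I_n) (x y : M) :=
  \sum_(m <- [seq m <- msupp p | (md (de m).1 == a) && (md (de m).2 == b)])
    Q m x y.
exists D, P; split=> [a b|x y dx dy].
  have -> : P a b = fun x y => \sum_(m <- msupp p |
      [&& m \in msupp p, md (de m).1 == a & md (de m).2 == b]) Q m x y.
    apply/funext => x; apply/funext => y; rewrite /P big_filter big_seq_cond.
    by apply: eq_bigl => m.
  apply: biform_sum => m /and3P[mp /eqP <- /eqP <-].
  have Dm : ((de m).1 + (de m).2 <= D)%N.
    by rewrite /D (big_rem m) //= leq_addr.
  apply: biformZ; have := biformM (deE m) (biformM
    (biformX (D - (de m).1 %/ n) (biform_det1 K n))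
    (biformX (D - (de m).2 %/ n) (biform_det2 K n))).
  congr biform => /=.
    rewrite mul0n addn0 {1}(divn_eq (de m).1 n) mulnBr addnAC addnC.
    congr (_ + _)%N; rewrite mulnC subnKC // leq_mul2l.
    by rewrite (leq_trans (leq_div _ _)) ?orbT // (leq_trans _ Dm) ?leq_addr.
  rewrite mul0n add0n {1}(divn_eq (de m).2 n) mulnBr addnAC addnC.
  congr (_ + _)%N; rewrite mulnC subnKC // leq_mul2l.
  by rewrite (leq_trans (leq_div _ _)) ?orbT // (leq_trans _ Dm) ?leq_addl.
rewrite /phi mevalE /P.
under [RHS]eq_bigr do under eq_bigr do rewrite big_filter big_mkcond.
under [RHS]eq_bigr do rewrite exchange_big.
rewrite exchange_big; apply: eq_bigr => m _ /=.
rewrite (bigD1 (md (de m).1)) //= [X in _ = _ + X]big1 ?addr0; last first.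
  by move=> a ma; rewrite big1 // => b _; rewrite eq_sym (negbTE ma).
rewrite (bigD1 (md (de m).2)) //= [X in _ = _ + X]big1 ?addr0; last first.
  by move=> b mb; rewrite [_ == b]eq_sym (negbTE mb) andbF.
by rewrite !eqxx /Q dx dy !expr1n !mulr1.
Qed.

Lemma det_conj (g x : M) : \det g = 1 -> \det (invmx g *m x *m g) = \det x.
Proof. by move=> dg; rewrite !det_mulmx det_inv dg invr1 mul1r mulr1. Qed.

Hypothesis phi_inv : forall g x y : M, \det g = 1 -> \det x = 1 -> \det y = 1 ->
  phi (invmx g *m x *m g) (invmx g *m y *m g) = phi x y.

(** Scaling x and y by n-th roots of unity z and w stays in SL and multiplies the defect of
    invariance of [P a b] by z^a w^b. Since the defects sum to zero for all z and w, each vanishes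
    on SL, and then everywhere by density in one variable at a time. *)
Lemma invariant_biform_decomposition :
  exists (D : nat) (P : 'I_n -> 'I_n -> M -> M -> K),
  [/\ forall a b : 'I_n, biform (a + n * D) (b + n * D) (P a b),
      forall x y, \det x = 1 -> \det y = 1 ->
        phi x y = \sum_a \sum_b P a b x y &
      forall a b g x y, \det g = 1 ->
        P a b (invmx g *m x *m g) (invmx g *m y *m g) = P a b x y].
Proof.
have [D [P [fP phiE]]] := biform_decomposition.
exists D, P; split=> // a b g x y dg.
have [rs [urs srs rs1]] := roots_of_unity_seq K n_gt0.
pose R (a b : 'I_n) x y := P a b (invmx g *m x *m g) (invmx g *m y *m g) - P a b x y.
have conjZ z (u : M) : invmx g *m (z *: u) *m g = z *: (invmx g *m u *m g).
  by rewrite -scalemxAr -scalemxAl.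
have RZ s t c d u v : R c d (s *: u) (t *: v) =
    s ^+ (c + n * D) * t ^+ (d + n * D) * R c d u v.
  by rewrite /R !conjZ !(biform_scale _ _ _ _ (fP _ _)) mulrBr.
have R_SL u v : \det u = 1 -> \det v = 1 -> forall c d, R c d u v = 0.
  move=> du dv c d.
  move: d; apply: (power_sums_eq0 urs srs) => w wrs.
  move: c; apply: (power_sums_eq0 urs srs) => z zrs.
  have zu : \det (z *: u) = 1 by rewrite detZ rs1 // mul1r.
  have wv : \det (w *: v) = 1 by rewrite detZ rs1 // mul1r.
  have := phi_inv dg zu wv.
  rewrite !phiE ?det_conj // => /eqP; rewrite -subr_eq0 => /eqP E0.
  rewrite -[RHS]E0 -sumrB; apply: eq_bigr => c _; rewrite -sumrB mulr_sumr.
  apply: eq_bigr => d _; rewrite -/(R c d (z *: u) (w *: v)) RZ.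
  by rewrite !exprD !exprM !rs1 // !expr1n !mulr1 mulrA.
apply/eqP; rewrite -subr_eq0 -/(R a b x y); apply/eqP.
(* Conjugation carries lines in the direction of the identity to such lines, so the conjugated form
   is also polynomial along them. *)
have shift u t : invmx g *m (u + t%:M) *m g = invmx g *m u *m g + t%:M.
  rewrite mulmxDr mulmxDl; congr (_ + _).
  by rewrite scalar_mxC -mulmxA mulVmx ?mulmx1 // unitmxE dg unitr1.
have subU := univariate_subalgebra K.
move: y; apply: (SL_density (d := b + n * D)) => // [s y|y|y dy].
- by rewrite -[x in LHS]scale1r RZ expr1n mul1r.
- apply: subalgebraB => //; last exact: biform_univariate2 (fP _ _).
  by under eq_fun do rewrite shift; apply: biform_univariate2 (fP _ _).
move: x; apply: (SL_density (d := a + n * D)) => // [s x|x|x dx].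
- by rewrite -[y in LHS]scale1r RZ expr1n mulr1.
- apply: subalgebraB => //; last exact: biform_univariate1 (fP _ _).
  by under eq_fun do rewrite shift; apply: biform_univariate1 (fP _ _).
exact: R_SL.
Qed.

Lemma invariant_in_trace_subalgebra (T : Type) (X Y : T -> M) (A : set (T -> K))
    (W : (T -> M) -> Prop) :
  (forall t, \det (X t) = 1) -> (forall t, \det (Y t) = 1) -> subalgebra A ->
  W X -> W Y -> W (fun=> 1%:M) ->
  (forall U V, W U -> W V -> W (fun t => U t *m V t)) ->
  (forall U, W U -> A (fun t => \tr (U t))) -> A (fun t => phi (X t) (Y t)).
Proof.
move=> dX dY subA WX WY W1 WM WA.
have [D [P [fP phiE invP]]] := invariant_biform_decomposition.
under eq_fun do rewrite phiE //.
apply: subalgebra_sum => // a _; apply: subalgebra_sum => // b _.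
have [|c cE] := invariant_biform_perm n_gt0 (fP a b); first exact: invP.
under eq_fun do rewrite cE.
apply: subalgebra_sum => // s _; apply: subalgebraZ => //.
have := permutation_trace_in_subalgebra
  (X := fun k t => slots (X t) (Y t) k) s n_gt0 subA W1 WM WA.
by apply=> k; rewrite /slots; case: (left_slot k).
Qed.

End Decomposition.

(** * Traces of words in two 3 x 3 matrices *)

Section CayleyHamilton3.
Variable K : numFieldType.
Implicit Types x u d : 'M[K]_3.

Let o0 : 'I_3 := @Ordinal 3 0 isT.
Let o1 : 'I_3 := @Ordinal 3 1 isT.
Let o2 : 'I_3 := @Ordinal 3 2 isT.

Let sum3 (F : 'I_3 -> K) : \sum_i F i = F o0 + F o1 + F o2.
Proof.
rewrite !big_ord_recr big_ord0 /= add0r.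
by congr (F _ + F _ + F _); apply: val_inj.
Qed.

Let ord3 (P : 'I_3 -> Prop) : P o0 -> P o1 -> P o2 -> forall i, P i.
Proof.
move=> P0 P1 P2; case=> [[|[|[|//]]] lt3].
- by rewrite (_ : Ordinal lt3 = o0) //; apply: val_inj.
- by rewrite (_ : Ordinal lt3 = o1) //; apply: val_inj.
- by rewrite (_ : Ordinal lt3 = o2) //; apply: val_inj.
Qed.

(** The second elementary symmetric function of the eigenvalues, written by Newton's formula so that
    it visibly is a polynomial in traces. *)
Definition minor_sum x : K := ((\tr x) ^+ 2 - \tr (x *m x)) / 2.

Let minor_sumE x : minor_sum x =
  x o0 o0 * x o1 o1 - x o0 o1 * x o1 o0 + x o0 o0 * x o2 o2
  - x o0 o2 * x o2 o0 + x o1 o1 * x o2 o2 - x o1 o2 * x o2 o1.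
Proof.
rewrite /minor_sum /mxtrace !sum3 !mxE !sum3.
by field.
Qed.

(** The part of the Cayley-Hamilton identity at x + u that is quadratic in x and linear in u. The
    scalar term is the derivative of the determinant at x along u, the trace of adj(x) u. *)
Lemma polarized_Cayley_Hamilton x u :
  x *m x *m u + x *m u *m x + u *m x *m x =
  \tr x *: (x *m u + u *m x) + \tr u *: (x *m x) - minor_sum x *: u
  - (\tr x * \tr u - \tr (x *m u)) *: x
  + (\tr (x *m x *m u) - \tr x * \tr (x *m u) + minor_sum x * \tr u)%:M.
Proof.
rewrite minor_sumE; apply/matrixP; apply: ord3; apply: ord3;
  rewrite /mxtrace !(mxE, sum3) /= ?mulr1n ?mulr0n; ring.
Qed.

Lemma det_trace3 x :
  3 * \det x = \tr (x *m x *m x) - \tr x * \tr (x *m x) + minor_sum x * \tr x.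
Proof.
rewrite minor_sumE (expand_det_row _ o0) sum3 /cofactor.
rewrite !(expand_det_row _ (@Ordinal 2 0 isT)) /cofactor.
rewrite !big_ord_recl !big_ord0 !det_mx11 /mxtrace !(mxE, sum3) /=.
(* Indexing entries by natural numbers identifies equal ordinals built in different ways, so that
   [ring] sees the same atoms. *)
have [m xE] : exists m : nat -> nat -> K, forall i j, x i j = m i j.
  by exists (fun k l => x (inord k) (inord l)) => i j; rewrite !inord_val.
by rewrite !xE /= /bump /=; ring.
Qed.

(** The polarized identity at u = x is three times this one, its scalar term being rewritten by
    [det_trace3]. *)
Lemma Cayley_Hamilton3 x :
  x *m x *m x = \tr x *: (x *m x) - minor_sum x *: x + (\det x)%:M.
Proof.
have K3 : 3 != 0 :> K by rewrite pnatr_eq0.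
have /matrixP H := polarized_Cayley_Hamilton x x.
apply/matrixP => i j; apply: (mulfI K3).
have {H} := H i j; have := det_trace3 x.
move: (x *m x *m x) => x3; rewrite /minor_sum; move: (x *m x) => x2 dE.
rewrite !mxE; case: (i == j); rewrite ?mulr1n ?mulr0n => H.
  have -> : 3 * x3 i j = x3 i j + x3 i j + x3 i j by ring.
  by rewrite H [RHS]mulrDr dE; field.
have -> : 3 * x3 i j = x3 i j + x3 i j + x3 i j by ring.
by rewrite H; field.
Qed.

Lemma polarized_trace_identity x u d :
  \tr (x *m x *m u *m d) + \tr (x *m u *m x *m d) + \tr (u *m x *m x *m d) =
  \tr x * (\tr (x *m u *m d) + \tr (u *m x *m d)) + \tr u * \tr (x *m x *m d)
  - minor_sum x * \tr (u *m d) - (\tr x * \tr u - \tr (x *m u)) * \tr (x *m d)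
  + (\tr (x *m x *m u) - \tr x * \tr (x *m u) + minor_sum x * \tr u) * \tr d.
Proof.
have := congr1 (fun m => \tr (m *m d)) (polarized_Cayley_Hamilton x u).
rewrite !mulmxDl !mulNmx -!scalemxAl !mulmxDl mul_scalar_mx.
by rewrite !mxtraceD !raddfN /= !mxtraceZ !mxtraceD.
Qed.

Lemma invmx_det1 x : \det x = 1 ->
  invmx x = x *m x - \tr x *: x + (minor_sum x)%:M.
Proof.
move=> dx; have xU : x \in unitmx by rewrite unitmxE dx unitr1.
rewrite -[RHS](mulKmx xU) -[LHS]mulmx1; congr (_ *m _).
rewrite mulmxDr mulmxBr -scalemxAr mul_mx_scalar mulmxA Cayley_Hamilton3 dx.
by move: (x *m x) => x2; apply/matrixP => i j; rewrite !mxE; ring.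
Qed.

End CayleyHamilton3.

(** With [true] for x and [false] for y: one word from each cyclic class having at most three
    letters of each kind and no three consecutive equal letters cyclically. *)
Definition word_representatives : seq (seq bool) :=
  let t := true in let f := false in
  [:: [::]; [:: t]; [:: f]; [:: t; t]; [:: f; f]; [:: t; f];
      [:: t; t; f]; [:: f; f; t]; [:: t; t; f; f]; [:: t; f; t; f];
      [:: t; f; t; t; f]; [:: f; t; f; f; t];
      [:: t; t; f; f; t; f]; [:: t; f; f; t; t; f]; [:: t; f; t; f; t; f]].

Definition starts_with_cube (w : seq bool) : bool :=
  if w is a :: b :: c :: _ then (a == b) && (b == c) else false.

(** Such words have length at most 6, so the claim is decided by computation over all of them and
    their rotations. *)
Lemma short_word_representative (w : seq bool) :
  (count_mem true w <= 3)%N && (count_mem false w <= 3)%N ->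
  exists i, (rot i w \in word_representatives) || starts_with_cube (rot i w).
Proof.
pose good w := (count_mem true w <= 3)%N && (count_mem false w <= 3)%N ==>
  has (fun i => (rot i w \in word_representatives) ||
                starts_with_cube (rot i w)) (iota 0 7).
pose words := iter 6 (fun ws => [::] :: [seq b :: w | b <- [:: true; false], w <- ws])
  [:: [::]].
have all_good : all good words by vm_compute.
move=> wle; suff /(allP all_good) : w \in words.
  by rewrite /good wle => /hasP[i _ iP]; exists i.
have : (size w <= 6)%N.
  have -> : size w = (count_mem true w + count_mem false w)%N.
    by rewrite -(count_predC (pred1 true) w); congr addn; apply: eq_count; case.
  by case/andP: wle => ? ?; lia.
rewrite /words; elim: 6%N (w) => [|k IH] [|b v] //= sv.
rewrite inE; apply/orP; right.
have := IH v sv; move: (iter _ _ _) => ws vws; rewrite cats0 mem_cat.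
by case: b; rewrite map_f ?orbT.
Qed.

(** * Reduction of traces of words modulo traces of shorter words *)

Section Words.
Variables (K : numFieldType) (T : Type) (X Y : T -> 'M[K]_3).
Hypotheses (det_X : forall t, \det (X t) = 1) (det_Y : forall t, \det (Y t) = 1).
Variable A : set (T -> K).
Hypothesis subA : subalgebra A.
Implicit Types (b : bool) (u v w d : seq bool).

Definition letter b (t : T) := if b then X t else Y t.

Definition word_eval w (t : T) : 'M[K]_3 :=
  foldr (fun b m => letter b t *m m) 1%:M w.

Lemma word_eval_cat u v t :
  word_eval (u ++ v) t = word_eval u t *m word_eval v t.
Proof. by elim: u => [|b u IH] /=; rewrite ?mul1mx // IH mulmxA. Qed.

Definition trace_in w := A (fun t => \tr (word_eval w t)).

Lemma trace_in_catC u v : trace_in (u ++ v) -> trace_in (v ++ u).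
Proof.
by congr A; apply/funext => t; rewrite !word_eval_cat mxtrace_mulC.
Qed.

Lemma trace_in_rot i w : trace_in (rot i w) -> trace_in w.
Proof. by move/trace_in_catC; rewrite cat_take_drop. Qed.

Hypothesis trace_letter : forall b, trace_in [:: b].
Hypothesis trace_square : forall b, trace_in [:: b; b].

Let trA b : A (fun t => \tr (letter b t)).
Proof. by move: (trace_letter b); congr A; apply/funext => t /=; rewrite mulmx1. Qed.

Let minorA b : A (fun t => minor_sum (letter b t)).
Proof.
have -> : (fun t => minor_sum (letter b t)) = (fun t => 2^-1 *
    (\tr (letter b t) * \tr (letter b t) - \tr (word_eval [:: b; b] t))).
  by apply/funext => t; rewrite /minor_sum /= mulmx1 expr2 mulrC.
apply: subalgebraZ => //; apply: subalgebraB => //; first exact: subalgebraM.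
exact: trace_square.
Qed.

(** Every word on the right of [polarized_trace_identity] is shorter than bbud: nonemptiness of u
    handles bbd, that of d handles bbu. Any two of the three traces therefore give the third. *)
Let polarA b u d : u != [::] -> d != [::] ->
  (forall w, (size w < size u + size d + 2)%N -> trace_in w) ->
  A (fun t => \tr (word_eval [:: b, b & u ++ d] t)
            + \tr (word_eval (b :: u ++ b :: d) t)
            + \tr (word_eval (u ++ [:: b, b & d]) t)).
Proof.
move=> u0 d0 IH.
have su : (0 < size u)%N by rewrite lt0n size_eq0.
have sd : (0 < size d)%N by rewrite lt0n size_eq0.
pose e w t := \tr (word_eval w t).
have -> : (fun t => \tr (word_eval [:: b, b & u ++ d] t)
            + \tr (word_eval (b :: u ++ b :: d) t)
            + \tr (word_eval (u ++ [:: b, b & d]) t)) =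
  (fun t => \tr (letter b t) * (e (b :: u ++ d) t + e (u ++ b :: d) t)
    + e u t * e [:: b, b & d] t - minor_sum (letter b t) * e (u ++ d) t
    - (\tr (letter b t) * e u t - e (b :: u) t) * e (b :: d) t
    + (e [:: b, b & u] t - \tr (letter b t) * e (b :: u) t
       + minor_sum (letter b t) * e u t) * e d t).
  apply/funext => t; have := polarized_trace_identity (letter b t)
    (word_eval u t) (word_eval d t).
  by rewrite /e !(word_eval_cat, mulmxA) /= !(word_eval_cat, mulmxA).
have eA w : (size w < size u + size d + 2)%N -> A (e w) by apply: IH.
by repeat first [apply: subalgebraB => // | apply: subalgebraD => //
  | apply: subalgebraM => //]; apply: eA; rewrite /= ?size_cat /=; lia.
Qed.

Let trace_in_bubd b u d : u != [::] -> d != [::] ->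
  (forall w, (size w < size u + size d + 2)%N -> trace_in w) ->
  trace_in [:: b, b & u ++ d] -> trace_in (u ++ [:: b, b & d]) ->
  trace_in (b :: u ++ b :: d).
Proof.
move=> u0 d0 IH P1 P2; have := polarA b u0 d0 IH.
move/subalgebraB => /(_ subA _ P1)/subalgebraB => /(_ subA _ P2).
by congr A; apply/funext => t; ring.
Qed.

Let trace_in_bbud b u d : u != [::] -> d != [::] ->
  (forall w, (size w < size u + size d + 2)%N -> trace_in w) ->
  trace_in (b :: u ++ b :: d) -> trace_in (u ++ [:: b, b & d]) ->
  trace_in [:: b, b & u ++ d].
Proof.
move=> u0 d0 IH P1 P2; have := polarA b u0 d0 IH.
move/subalgebraB => /(_ subA _ P1)/subalgebraB => /(_ subA _ P2).
by congr A; apply/funext => t; ring.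
Qed.

Let trace_in_cube b d :
  (forall w, (size w < size d + 3)%N -> trace_in w) ->
  trace_in [:: b, b, b & d].
Proof.
move=> IH.
have -> : trace_in [:: b, b, b & d] = A (fun t =>
    \tr (letter b t) * \tr (word_eval [:: b, b & d] t)
    - minor_sum (letter b t) * \tr (word_eval (b :: d) t)
    + \tr (word_eval d t)).
  congr A; apply/funext => t /=; rewrite !mulmxA Cayley_Hamilton3.
  have -> : \det (letter b t) = 1 by rewrite /letter; case: b.
  rewrite !mulmxDl mulNmx -!scalemxAl mul1mx.
  by rewrite !mxtraceD raddfN /= !mxtraceZ.
apply: subalgebraD => //; last by apply: IH; lia.
apply: subalgebraB => //; apply: subalgebraM => //; apply: IH => /=; lia.
Qed.

Section ManyLetters.
Variable N : nat.
Hypothesis IH : forall w, (size w < N)%N -> trace_in w.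

(** The name lists the lengths of the runs of b singled out. For nonempty u, the other two words of
    the polarized relation contain bbb cyclically. *)
Let trace_in_2_2 b u d : (size u + size d + 4)%N = N ->
  trace_in (b :: b :: u ++ b :: b :: d).
Proof.
move=> sN; have [->|u0] := eqVneq u [::].
  by apply: trace_in_cube => w sw; apply: IH; move: sw => /=; lia.
apply: trace_in_bbud => // [w sw| |].
- by apply: IH; move: sw => /=; lia.
- rewrite -cat_cons; apply: (@trace_in_catC [:: b, b, b & d]).
  by apply: trace_in_cube => w; rewrite size_cat /= => sw; apply: IH; lia.
- apply: (@trace_in_catC [:: b, b, b, b & d]).
  by apply: trace_in_cube => w; rewrite /= size_cat /= => sw; apply: IH; lia.
Qed.

(** Moving together the two isolated letters around q leaves words with two pairs bb. *)
Let trace_in_2_1_1 b p q r : (size p + size q + size r + 4)%N = N ->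
  trace_in (b :: b :: p ++ b :: q ++ b :: r).
Proof.
move=> sN; have [q0|q0] := eqVneq q [::].
  by move: sN; rewrite q0 => sN; apply: trace_in_2_2; rewrite -sN /=; lia.
rewrite (_ : _ :: _ = (b :: b :: p) ++ b :: q ++ b :: r) //.
apply: trace_in_catC.
rewrite (_ : _ ++ _ = b :: q ++ b :: (r ++ b :: b :: p)); last first.
  by rewrite /= -catA.
apply: trace_in_bubd => // [|w sw| |].
- by case: (r).
- by apply: IH; move: sw; rewrite size_cat /=; lia.
- by rewrite catA; apply: trace_in_2_2; rewrite size_cat; lia.
- apply: (@trace_in_catC (b :: b :: r ++ b :: b :: p)).
  by rewrite /= -catA /=; apply: trace_in_2_2; rewrite size_cat; lia.
Qed.

Let trace_in_1_1_1_1 b p q r s :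
  (size p + size q + size r + size s + 4)%N = N ->
  trace_in (b :: p ++ b :: q ++ b :: r ++ b :: s).
Proof.
move=> sN; have [p0|p0] := eqVneq p [::].
  by move: sN; rewrite p0 => sN; apply: trace_in_2_1_1; rewrite -sN /=; lia.
apply: trace_in_bubd => // [|w sw| |].
- by case: (q).
- by apply: IH; move: sw; do ?rewrite size_cat /=; lia.
- by rewrite catA; apply: trace_in_2_1_1; rewrite size_cat; lia.
- apply: (@trace_in_catC (b :: b :: q ++ b :: r ++ b :: s)).
  rewrite (_ : _ ++ p = b :: b :: q ++ b :: r ++ b :: (s ++ p)).
    by apply: trace_in_2_1_1; rewrite size_cat; lia.
  by rewrite /= -!catA /= -catA.
Qed.

Let count_split b m w : count_mem b w = m.+1 ->
  exists w1 w2, w = w1 ++ b :: w2 /\ count_mem b w2 = m.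
Proof.
elim: w => //= c w IHw; have [->|cb] := eqVneq c b.
  by case=> wm; exists [::], w.
by case/IHw => w1 [w2 [-> w2m]]; exists (c :: w1), w2.
Qed.

Lemma trace_in_many b w : size w = N -> (3 < count_mem b w)%N -> trace_in w.
Proof.
move=> sw; case wm: (count_mem b w) => [|[|[|[|m]]]] // _.
have [w1 [w2 [wE]]] := count_split wm.
case/count_split => p [w3 [w2E]] /count_split[q [w4 [w3E]]].
case/count_split => r [s [w4E _]].
move: sw; rewrite wE w2E w3E w4E => sw.
apply: trace_in_catC.
rewrite (_ : _ ++ w1 = b :: p ++ b :: q ++ b :: r ++ b :: (s ++ w1)).
  apply: trace_in_1_1_1_1; move: sw.
  by do ?rewrite size_cat /=; lia.
by rewrite /= -!catA /= -!catA /= -catA.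
Qed.

End ManyLetters.
Hypothesis trace_mixed : trace_in [:: true; false].
Hypothesis trace_bbc : forall b, trace_in [:: b; b; ~~ b].
Hypothesis trace_bbcc : trace_in [:: true; true; false; false].
Hypothesis trace_bbccbc :
  (forall w, (size w < 6)%N -> trace_in w) ->
  trace_in [:: true; true; false; false; true; false].

Lemma trace_in_words w : trace_in w.
Proof.
have [N] := ubnP (size w); elim: N w => // N IHN w; rewrite ltnS => sw.
have IH v : (size v < size w)%N -> trace_in v.
  by move=> sv; apply: IHN; apply: leq_trans sw.
have [many|few] := boolP (has (fun b => 3 < count_mem b w)%N [:: true; false]).
  by have /hasP[b _] := many; apply: trace_in_many (erefl _).
case: (@short_word_representative w) => [|i].
  move: few; rewrite /= orbF negb_or -!leqNgt => /andP[wt wf].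
  by rewrite wt wf.
rewrite -(size_rot i w) in IH; move=> wi; apply: (@trace_in_rot i).
move: (rot i w) wi IH => {few sw IHN i} {}w.
have cube b d : (forall v, (size v < size d + 3)%N -> trace_in v) ->
  trace_in [:: b, b, b & d] by apply: trace_in_cube.
(* After one rotation the outer letter is the other one, c, and joining the two c on either side of
   bb brings all three b together cyclically. *)
have cbbcb b : (forall v, (size v < 5)%N -> trace_in v) ->
    trace_in [:: b; ~~ b; b; b; ~~ b].
  move=> IH; apply: (@trace_in_rot 1).
  apply: (@trace_in_bubd (~~ b) [:: b; b] [:: b]) => //.
    by apply: (@trace_in_rot 2); apply: cube.
  by apply: (@trace_in_rot 4); apply: cube.
(* Of the other two words in the relation one is a rotation of xxyyxy and one contains a cube. *)
have bbcbcc : (forall v, (size v < 6)%N -> trace_in v) ->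
    trace_in [:: true; true; false; true; false; false].
  move=> IH; apply: (@trace_in_bbud true [:: false] [:: true; false; false]) => //.
    by apply: (@trace_in_rot 2); apply: trace_bbccbc.
  by apply: (@trace_in_rot 1); apply: cube.
case/orP; last first.
  case: w => [|a [|b [|c d]]] //= /andP[/eqP -> /eqP ->] IH.
  by apply: cube => v; rewrite addn3; apply: IH.
rewrite !inE.
case/predU1P => [-> IH|]; first exact: (subalgebra_const subA (\tr (1%:M : 'M[K]_3))).
case/predU1P => [-> IH|]; first exact: trace_letter.
case/predU1P => [-> IH|]; first exact: trace_letter.
case/predU1P => [-> IH|]; first exact: trace_square.
case/predU1P => [-> IH|]; first exact: trace_square.
case/predU1P => [-> IH|]; first exact: trace_mixed.
case/predU1P => [-> IH|]; first exact: trace_bbc.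
case/predU1P => [-> IH|]; first exact: trace_bbc.
case/predU1P => [-> IH|]; first exact: trace_bbcc.
case/predU1P => [-> IH|].
  apply: (@trace_in_bubd true [:: false] [:: false]) => //.
  by apply: (@trace_in_rot 1).
case/predU1P => [-> IH|]; first exact: cbbcb.
case/predU1P => [-> IH|]; first exact: (cbbcb false).
case/predU1P => [-> IH|]; first exact: trace_bbccbc.
case/predU1P => [-> IH|]; first by apply: (@trace_in_rot 3); apply: bbcbcc.
move/eqP=> -> IH.
apply: (@trace_in_bubd true [:: false] [:: false; true; false]) => //.
  exact: trace_bbccbc.
by apply: (@trace_in_rot 1); apply: bbcbcc.
Qed.

End Words.

Lemma mxtrace_invmx_det1 (K : numFieldType) (x : 'M[K]_3) :
  \det x = 1 -> \tr (invmx x) = minor_sum x.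
Proof.
move=> dx; rewrite invmx_det1 // mxtraceD raddfB /= mxtraceZ mxtrace_scalar.
by rewrite /minor_sum; field.
Qed.

(** Replacing inverses by [invmx_det1] gives each generator a leading positive word plus traces of
    shorter ones: xxy, xyy and xxyy come from the mixed traces of length two with inverses, and
    xyxxyy from the commutator. *)
Lemma trace_in_of_generators (K : numFieldType) (T : Type) (X Y : T -> 'M[K]_3)
    (A : set (T -> K)) :
  (forall t, \det (X t) = 1) -> (forall t, \det (Y t) = 1) -> subalgebra A ->
  A (fun t => \tr (X t)) -> A (fun t => \tr (Y t)) ->
  A (fun t => \tr (X t *m Y t)) -> A (fun t => \tr (X t *m invmx (Y t))) ->
  A (fun t => \tr (invmx (X t))) -> A (fun t => \tr (invmx (Y t))) ->
  A (fun t => \tr (invmx (X t) *m invmx (Y t))) ->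
  A (fun t => \tr (invmx (X t) *m Y t)) ->
  A (fun t => \tr (X t *m Y t *m invmx (X t) *m invmx (Y t))) ->
  forall w, trace_in X Y A w.
Proof.
move=> dX dY subA AX AY AXY AXy Ax Ay Axy AxY Ac.
have e2 (U : T -> 'M[K]_3) t : \det (U t) = 1 ->
    \tr (U t *m U t) = \tr (U t) * \tr (U t) - 2 * \tr (invmx (U t)).
  by move=> dU; rewrite mxtrace_invmx_det1 // /minor_sum; field.
pose expand := (mulmxDl, mulmxDr, mulNmx, mulmxN, mul_scalar_mx, mul_mx_scalar).
have mxtraceN (m : 'M[K]_3) : \tr (- m) = - \tr m by rewrite raddfN.
pose traces := (mxtraceD, mxtraceN, @mxtraceZ K 3, mxtrace_scalar).
have P1 b : trace_in X Y A [:: b].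
  by rewrite /trace_in /=; under eq_fun do rewrite mulmx1; case: b.
have P2 b : trace_in X Y A [:: b; b].
  rewrite /trace_in /=; under eq_fun do rewrite mulmx1.
  by case: b; under eq_fun do rewrite e2 //; apply: subalgebraB => //;
    [exact: subalgebraM|exact: subalgebraZ|exact: subalgebraM|exact: subalgebraZ].
have PTF : trace_in X Y A [:: true; false].
  by rewrite /trace_in /=; under eq_fun do rewrite mulmx1.
have PTTF : trace_in X Y A [:: true; true; false].
  have -> : trace_in X Y A [:: true; true; false] = A (fun t =>
      \tr (invmx (X t) *m Y t) + \tr (X t) * \tr (X t *m Y t)
      - \tr (invmx (X t)) * \tr (Y t)).
    congr A; apply/funext => t; rewrite [in RHS]mxtrace_invmx_det1 //.
    rewrite invmx_det1 //= mulmx1 !expand -!scalemxAl !traces mulmxA.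
    by ring.
  apply: subalgebraB => //; last exact: subalgebraM.
  by apply: subalgebraD => //; exact: subalgebraM.
have PTFF : trace_in X Y A [:: true; false; false].
  have -> : trace_in X Y A [:: true; false; false] = A (fun t =>
      \tr (X t *m invmx (Y t)) + \tr (Y t) * \tr (X t *m Y t)
      - \tr (invmx (Y t)) * \tr (X t)).
    congr A; apply/funext => t; rewrite [in RHS]mxtrace_invmx_det1 //.
    rewrite invmx_det1 //= mulmx1 !expand -!scalemxAr !traces.
    by ring.
  apply: subalgebraB => //; last exact: subalgebraM.
  by apply: subalgebraD => //; exact: subalgebraM.
have PTTFF : trace_in X Y A [:: true; true; false; false].
  pose e w t := \tr (word_eval X Y w t).
  have -> : trace_in X Y A [:: true; true; false; false] = A (fun t =>
      \tr (invmx (X t) *m invmx (Y t))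
      + (\tr (Y t) * e [:: true; true; false] t
         - \tr (invmx (Y t)) * e [:: true; true] t)
      + \tr (X t) * (e [:: true; false; false] t
         - \tr (Y t) * \tr (X t *m Y t) + \tr (invmx (Y t)) * \tr (X t))
      - \tr (invmx (X t)) * (e [:: false; false] t
         - \tr (Y t) * \tr (Y t) + 3 * \tr (invmx (Y t)))).
    congr A; apply/funext => t; rewrite !mxtrace_invmx_det1 //.
    rewrite !invmx_det1 // /e /= !mulmx1 !expand -?scalemxAr -?scalemxAl.
    rewrite !traces !mulmxA.
    by ring.
  have eA w : trace_in X Y A w -> A (e w) by [].
  have [e1 e3 e4 e5] := And4 (eA _ PTTF) (eA _ (P2 true)) (eA _ PTFF) (eA _ (P2 false)).
  by repeat first [done | apply: subalgebraB => // | apply: subalgebraD => //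
    | apply: subalgebraM => // | exact: subalgebra_const].
apply: trace_in_words => //.
- by case=> //; apply: (@trace_in_catC _ _ _ _ _ [:: true] [:: false; false]).
(* The leading word of the commutator, a rotation of xxyyxy. *)
move=> IH; pose w0 := [:: true; false; true; true; false; false].
apply: (@trace_in_rot _ _ _ _ _ 4); rewrite -[rot _ _]/w0.
pose e w t := \tr (word_eval X Y w t).
pose x := true; pose y := false.
have -> : trace_in X Y A w0 = A (fun t =>
    \tr (X t *m Y t *m invmx (X t) *m invmx (Y t))
    + (\tr (Y t) * e [:: x; y; x; x; y] t
       - \tr (invmx (Y t)) * e [:: x; y; x; x] t)
    + \tr (X t) * (e [:: x; y; x; y; y] t
       - \tr (Y t) * e [:: x; y; x; y] t + \tr (invmx (Y t)) * e [:: x; y; x] t)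
    - \tr (invmx (X t)) * (e [:: x; y; y; y] t
       - \tr (Y t) * e [:: x; y; y] t + \tr (invmx (Y t)) * e [:: x; y] t)).
  congr A; apply/funext => t; rewrite !mxtrace_invmx_det1 //.
  rewrite !invmx_det1 // /e /= !mulmx1 !expand -?scalemxAr -?scalemxAl.
  rewrite !traces !mulmxA.
  by ring.
have eA w : (size w < 6)%N -> A (e w) by exact: IH.
by repeat first [done | exact: eA | apply: subalgebraB => // | apply: subalgebraD => //
  | apply: subalgebraM => // | exact: subalgebra_const].
Qed.

(** * The generators are invariant *)

Section Invariants.
Variables (K : numFieldType).
Local Notation G := (SL K 3).
Local Notation coord := (SLpair_coordinate_ring K 3).

Lemma polynomial_functions_subalgebra (X : Type) m (iota : X -> 'rV[K]_m) :
  subalgebra (polynomial_functions iota).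
Proof.
split=> [|a f [p fp]|f g [p fp] [q gq]|f g [p fp] [q gq]].
- by exists 1 => x; rewrite meval1.
- by exists (a *: p) => x; rewrite /= fp mevalZ.
- by exists (p + q) => x; rewrite /= fp gq mevalD.
- by exists (p * q) => x; rewrite /= fp gq mevalM.
Qed.

Lemma SLpair_invariants_subalgebra : subalgebra (SLpair_invariants K 3).
Proof.
have [S1 SZ SD SM] := polynomial_functions_subalgebra (@SLpair_entries K 3).
split=> [|a f [cf If]|f g [cf If] [cg Ig]|f g [cf If] [cg Ig]]; split.
- exact: S1.
- by [].
- exact: SZ.
- by move=> h; rewrite -[in RHS](If h).
- exact: SD.
- by move=> h; rewrite -[in RHS](If h) -[in RHS](Ig h).
- exact: SM.
- by move=> h; rewrite -[in RHS](If h) -[in RHS](Ig h).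
Qed.

Definition polynomial_matrix (W : G * G -> 'M[K]_3) :=
  forall i j, coord (fun x => W x i j).

Let subC : subalgebra coord := polynomial_functions_subalgebra _.

Lemma polynomial_fst : polynomial_matrix (fun x => x.1).
Proof.
move=> i j; exists 'X_(lshift _ (mxvec_index i j)) => x.
by rewrite mevalXU row_mxEl mxvecE.
Qed.

Lemma polynomial_snd : polynomial_matrix (fun x => x.2).
Proof.
move=> i j; exists 'X_(rshift _ (mxvec_index i j)) => x.
by rewrite mevalXU row_mxEr mxvecE.
Qed.

Lemma polynomial_matrixM V W : polynomial_matrix V -> polynomial_matrix W ->
  polynomial_matrix (fun x => V x *m W x).
Proof.
move=> pV pW i j; under eq_fun do rewrite mxE.
by apply: (subalgebra_sum subC) => k _; apply: (subalgebraM subC).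
Qed.

Lemma polynomial_mxtrace W : polynomial_matrix W -> coord (fun x => \tr (W x)).
Proof. by move=> pW; apply: (subalgebra_sum subC). Qed.

(** By Cayley-Hamilton, inversion is polynomial on matrices of determinant 1. *)
Lemma polynomial_invmx W : (forall x, \det (W x) = 1) -> polynomial_matrix W ->
  polynomial_matrix (fun x => invmx (W x)).
Proof.
move=> dW pW i j; under eq_fun do rewrite invmx_det1 //.
have pWW := polynomial_matrixM pW pW.
have tW := polynomial_mxtrace pW; have tWW := polynomial_mxtrace pWW.
have mW : coord (fun x => minor_sum (W x)).
  rewrite /minor_sum; under eq_fun do rewrite mulrC expr2.
  apply: (subalgebraZ subC); apply: (subalgebraB subC) => //.
  exact: (subalgebraM subC).
have entryE (m w : 'M[K]_3) (t e : K) :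
    (m - t *: w + e%:M) i j = m i j - t * w i j + (i == j)%:R * e.
  by rewrite !mxE mulr_natl.
under eq_fun do rewrite entryE.
apply: (subalgebraD subC); last exact: (subalgebraZ subC).
by apply: (subalgebraB subC) => //; apply: (subalgebraM subC).
Qed.

Lemma SLpair_invariant_trace (w : G -> G -> G) :
  polynomial_matrix (fun x => w x.1 x.2) ->
  (forall g a b : G, w (g^-1 * a * g)%g (g^-1 * b * g)%g = (g^-1 * w a b * g)%g) ->
  SLpair_invariants K 3 (fun x => \tr (w x.1 x.2)).
Proof.
move=> pw wJ; split; first exact: polynomial_mxtrace.
move=> g; apply/funext => x; rewrite /SLpair_act /= wJ /=.
by rewrite mxtrace_mulC mulmxA mulmxV ?mul1mx // SL_unitmx.
Qed.

End Invariants.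

Local Open Scope classical_set_scope.
Local Open Scope ring_scope.

Theorem lemma5 (R : realType) :
  let G := SL R[i] 3 in
  let tr (w : G -> G -> G) : G * G -> R[i] := fun x => \tr (w x.1 x.2) in
  SLpair_invariants R[i] 3 =
  generated_subalgebra
    [set tr (fun x1 x2 => x1);
         tr (fun x1 x2 => x2);
         tr (fun x1 x2 => x1 * x2)%g;
         tr (fun x1 x2 => x1 * x2^-1)%g;
         tr (fun x1 x2 => x1^-1)%g;
         tr (fun x1 x2 => x2^-1)%g;
         tr (fun x1 x2 => x1^-1 * x2^-1)%g;
         tr (fun x1 x2 => x1^-1 * x2)%g;
         tr (fun x1 x2 => x1 * x2 * x1^-1 * x2^-1)%g].
Proof.
(* The generated subalgebra is an intersection, so the first inclusion is tested on an arbitrary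
   subalgebra [A] containing the nine traces. *)
move=> G tr; apply/seteqP; split=> [f [[p fp] fI] A [subA SA]|].
  pose X (t : G * G) : 'M[R[i]]_3 := t.1; pose Y (t : G * G) : 'M[R[i]]_3 := t.2.
  have dX t : \det (X t) = 1 by exact: SL_det.
  have dY t : \det (Y t) = 1 by exact: SL_det.
  have words : forall w, trace_in X Y A w.
    apply: (trace_in_of_generators dX dY subA); apply: SA.
    - by do 8!left.
    - by do 7!left; right.
    - by do 6!left; right.
    - by do 5!left; right.
    - by do 4!left; right.
    - by do 3!left; right.
    - by do 2!left; right.
    - by left; right.
    - by right.
  have -> : f = fun t => p.@[row_mx (mxvec (X t)) (mxvec (Y t)) 0].
    by apply/funext => t; rewrite fp.
  have FFT := @invariant_in_trace_subalgebra R[i] 3 p isT.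
  apply: (FFT _ _ X Y A (fun U => exists w, U = word_eval X Y w)) => //.
  - move=> g x y dg dx dy.
    pose g' : G := MkSL (introT eqP dg); pose x' : G := MkSL (introT eqP dx).
    pose y' : G := MkSL (introT eqP dy).
    have := congr1 (fun F => F (x', y')) (fI g').
    by rewrite /SLpair_act !fp.
  - by exists [:: true]; apply/funext => t; rewrite /= mulmx1.
  - by exists [:: false]; apply/funext => t; rewrite /= mulmx1.
  - by exists [::].
  - move=> U V [u ->] [v ->]; exists (u ++ v).
    by apply/funext => t; rewrite word_eval_cat.
  - by move=> U [w ->]; apply: words.
apply: smallest_sub; first exact: SLpair_invariants_subalgebra.
have pX := @polynomial_fst R[i]; have pY := @polynomial_snd R[i].
have pXi := polynomial_invmx (fun t => SL_det t.1) pX.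
have pYi := polynomial_invmx (fun t => SL_det t.2) pY.
have conjM (g a b : G) :
    (g^-1 * a * g * (g^-1 * b * g) = g^-1 * (a * b) * g)%g.
  by rewrite !mulgA mulgK.
have conjV (g a : G) : ((g^-1 * a * g)^-1 = g^-1 * a^-1 * g)%g.
  by rewrite !invMg invgK mulgA.
have inv (w : G -> G -> G) : polynomial_matrix (fun x => w x.1 x.2) ->
    (forall g a b, w (g^-1 * a * g)%g (g^-1 * b * g)%g = (g^-1 * w a b * g)%g) ->
    SLpair_invariants R[i] 3 (tr w).
  exact: SLpair_invariant_trace.
have pM := @polynomial_matrixM R[i].
move=> f; case=> [|->]; last first.
  apply: inv => [|g a b]; last by rewrite !conjV !conjM.
  exact: pM (pM _ _ (pM _ _ pX pY) pXi) pYi.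
case=> [|->]; last first.
  by apply: inv => [|g a b]; [exact: pM pXi pY | rewrite !conjV !conjM].
case=> [|->]; last first.
  by apply: inv => [|g a b]; [exact: pM pXi pYi | rewrite !conjV !conjM].
case=> [|->]; last first.
  by apply: inv => [|g a b]; [exact: pYi | rewrite !conjV].
case=> [|->]; last first.
  by apply: inv => [|g a b]; [exact: pXi | rewrite !conjV].
case=> [|->]; last first.
  by apply: inv => [|g a b]; [exact: pM pX pYi | rewrite !conjV !conjM].
case=> [|->]; last first.
  by apply: inv => [|g a b]; [exact: pM pX pY | rewrite !conjM].
by case=> ->; apply: inv.
Qed.
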